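(* Let $n\ge1$ and $0<p<\infty$. There is a finite constant $E_{p,n}$ such that for all nonnegative functions $F_1,\dots,F_{n+1}\in L^p(\mathbb{H}^n)$, $$\prod_{j=1}^{n+1}\|F_j\|_{L^p(\mathbb{H}^n)}\le E_{p,n}\,\sup_{q_1,\dots,q_{n+1}\in\mathbb{H}^n}\ \prod_{j=1}^{n+1}F_j(q_j)\,\det(q_1,\dots,q_{n+1})^{\frac{n+1}{p}},$$ where $\det(q_1,\dots,q_{n+1})$ is the absolute value of the determinant of the $(n+1)\times(n+1)$ matrix $(q_1,\dots,q_{n+1})$.
   Context: $\mathbb{H}^n=\{q=(q_1,\dots,q_n,q_{n+1})\in\mathbb{R}^n\times\mathbb{R}: q_1^2+\dots+q_n^2-q_{n+1}^2=-1\}$ (both sheets; in this definition the $q_i$ are coordinates of a point $q$), equipped with the measure $d\nu(q)$ invariant under the Lorentz group $O(1,n)$, i.e. $d\nu=dq_1\cdots dq_n/|q_{n+1}|$ on each sheet (up to normalization). In the claim, $q_1,\dots,q_{n+1}$ are points of $\mathbb{H}^n\subset\mathbb{R}^{n+1}$. $L^p(\mathbb{H}^n)=L^p(\mathbb{H}^n,d\nu)$ with $\|F\|_{L^p}=(\int|F|^p\,d\nu)^{1/p}$ (also for $p<1$). $\sup$ denotes the essential supremum with respect to the product measure $\nu\otimes\cdots\otimes\nu$. *)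

(* Defs.v *)
From HB Require Import structures.
From mathcomp Require Import all_boot all_order all_algebra.
From mathcomp Require Import all_classical all_reals all_analysis.
From mathcomp Require Import measurable_realfun.

Set Implicit Arguments.
Unset Strict Implicit.
Unset Printing Implicit Defensive.
Import Order.TTheory GRing.Theory Num.Theory.
Import numFieldNormedType.Exports.

Local Open Scope classical_set_scope.
Local Open Scope ring_scope.

Section tuple_measure.
Context d (T : measurableType d) (R : realType).
Variable mu : {sigma_finite_measure set T -> \bar R}.

Definition tuple_cons n (xt : T * n.-tuple T) : n.+1.-tuple T :=
  [tuple of xt.1 :: xt.2].

Lemma measurable_tuple_cons n : measurable_fun setT (@tuple_cons n).
Proof. exact: measurable_cons. Qed.

Section step.
Variables (n : nat) (nu : {sigma_finite_measure set (n.-tuple T) -> \bar R}).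

Definition tuple_measure_cons : set (n.+1.-tuple T) -> \bar R :=
  pushforward (mu \x nu)%E (@tuple_cons n).

Let mcons (A : set (n.+1.-tuple T)) :
  measurable A -> measurable (@tuple_cons n @^-1` A).
Proof. by move=> mA; rewrite -[X in measurable X]setTI; exact: measurable_tuple_cons. Qed.

Let tuple_measure_cons0 : tuple_measure_cons set0 = 0%E.
Proof. by rewrite /tuple_measure_cons /pushforward preimage_set0 measure0. Qed.

Let tuple_measure_cons_ge0 A : (0 <= tuple_measure_cons A)%E.
Proof. by rewrite /tuple_measure_cons /pushforward measure_ge0. Qed.

Let tuple_measure_cons_sigma_additive : semi_sigma_additive tuple_measure_cons.
Proof.
move=> F mF tF mUF; rewrite /tuple_measure_cons /pushforward preimage_bigcup.
apply: measure_semi_sigma_additive.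
- by move=> i; exact: mcons.
- apply/trivIsetP => /= i j _ _ ij; rewrite -preimage_setI.
  by move/trivIsetP : tF => /(_ _ _ _ _ ij) ->//; rewrite preimage_set0.
- by rewrite -preimage_bigcup; exact: mcons.
Qed.

HB.instance Definition _ := isMeasure.Build _ _ _ tuple_measure_cons
  tuple_measure_cons0 tuple_measure_cons_ge0 tuple_measure_cons_sigma_additive.

Let measurable_tuple_uncons (A : set T) (B : set (n.-tuple T)) :
  measurable A -> measurable B ->
  measurable ([set t | A (thead t) /\ B [tuple of behead t]] : set (n.+1.-tuple T)).
Proof.
move=> mA mB; apply: measurableI.
  have := @measurable_tnth _ T n.+1 ord0.
  by move=> /(_ measurableT _ mA); rewrite setTI.
have := @measurable_behead _ T n.
by move=> /(_ measurableT _ mB); rewrite setTI.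
Qed.

Let tuple_measure_cons_sigma_finite : sigma_finite setT tuple_measure_cons.
Proof.
have /sigma_finiteP[F [TF ndF Foo]] := sigma_finiteT mu.
have /sigma_finiteP[G [TG ndG Goo]] := sigma_finiteT nu.
exists (fun k => [set t | F k (thead t) /\ G k [tuple of behead t]]).
  apply/seteqP; split=> // t _.
  have [i _ Fi] : (\bigcup_i F i) (thead t) by rewrite -TF.
  have [j _ Gj] : (\bigcup_i G i) [tuple of behead t] by rewrite -TG.
  exists (maxn i j) => //=; split.
  - by move: Fi; exact/subsetPset/ndF/leq_maxl.
  - by move: Gj; exact/subsetPset/ndG/leq_maxr.
move=> k; have [mF Fk] := Foo k; have [mG Gk] := Goo k.
split; first exact: measurable_tuple_uncons.
rewrite /tuple_measure_cons /pushforward.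
rewrite [X in (mu \x nu)%E X](_ : _ = F k `*` G k).
  by rewrite product_measure1E// lte_mul_pinfty// ge0_fin_numE.
apply/seteqP; split=> -[x t] /=; rewrite theadE.
  by rewrite [X in G k X](_ : _ = t)//; apply/val_inj.
by rewrite [X in _ -> _ /\ G k X](_ : _ = t)//; apply/val_inj.
Qed.

HB.instance Definition _ := Measure_isSigmaFinite.Build _ _ _
  tuple_measure_cons tuple_measure_cons_sigma_finite.

End step.

Definition tuple_dirac : set (0.-tuple T) -> \bar R := \d_[tuple].
HB.instance Definition _ := Measure.on tuple_dirac.
Let tuple_dirac_fin : fin_num_fun tuple_dirac.
Proof. by move=> A mA; rewrite /tuple_dirac /dirac indicE. Qed.
HB.instance Definition _ :=
  Measure_isFinite.Build _ _ _ tuple_dirac tuple_dirac_fin.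

(* The n-fold product measure; see tuple_measure_box for its values on boxes. *)
Fixpoint tuple_measure n : {sigma_finite_measure set (n.-tuple T) -> \bar R} :=
  match n with
  | 0 => [the {sigma_finite_measure set (0.-tuple T) -> \bar R} of tuple_dirac]
  | m.+1 => [the {sigma_finite_measure set (m.+1.-tuple T) -> \bar R}
              of tuple_measure_cons (tuple_measure m)]
  end.

Lemma tuple_measure_box n (A : 'I_n -> set T) : (forall i, measurable (A i)) ->
  tuple_measure n [set t | forall i, A i (tnth t i)] =
  (\big[*%E/1]_(i < n) mu (A i))%E.
Proof.
elim: n A => [|n ih] A mA.
  rewrite big_ord0 /= /tuple_dirac /dirac indicE mem_set//=.
  by case.
rewrite big_ord_recl -ih// /= /tuple_measure_cons /pushforward.
rewrite -product_measure1E//; last first.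
  rewrite [X in measurable X](_ : _ =
      \bigcap_(i in [set: 'I_n]) ((@tnth _ T ^~ i) @^-1` A (lift ord0 i))).
    apply: fin_bigcap_measurable => // i _.
    by have := @measurable_tnth _ T n i measurableT _ (mA (lift ord0 i)); rewrite setTI.
  by apply/seteqP; split=> t /= h i; [move=> _; exact: h|exact: h].
congr ((_ \x _)%E _); apply/seteqP; split=> -[x t] /=.
  move=> h; split; first exact: (h ord0).
  by move=> i; have := h (lift ord0 i); rewrite tnthS.
move=> [h0 h] i; have [j ->|->//] := unliftP ord0 i.
by rewrite tnthS; exact: h.
Qed.

End tuple_measure.

Definition lebesgue_measure_tuple (R : realType) (n : nat) :
    {sigma_finite_measure set (n.-tuple (measurableTypeR R)) -> \bar R} :=
  tuple_measure [the {sigma_finite_measure set _ -> \bar R} of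
                 @lebesgue_measure R] n.

Section hyperboloid.
Variables (R : realType) (n : nat).
Local Notation Rn := (n.-tuple (measurableTypeR R)).
Local Notation Rn1 := (n.+1.-tuple (measurableTypeR R)).

Definition lorentz_sq (q : Rn1) : R :=
  \sum_(i < n) tnth q (widen_ord (leqnSn n) i) ^+ 2 - tnth q ord_max ^+ 2.

Record hyperboloid := Hyperboloid {
  hpt :> Rn1;
  hptP : lorentz_sq hpt == -1 }.

HB.instance Definition _ := [isSub for hpt].
HB.instance Definition _ := [Choice of hyperboloid by <:].

Definition height (x : Rn) : R := Num.sqrt (1 + \sum_(i < n) tnth x i ^+ 2).

Definition sheet_pt (s : bool) (x : Rn) : Rn1 :=
  [tuple of rcons x ((-1) ^+ s * height x)].

Lemma sheet_pt_widen s x (i : 'I_n) :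
  tnth (sheet_pt s x) (widen_ord (leqnSn n) i) = tnth x i.
Proof.
by rewrite !(tnth_nth 0)/= nth_rcons size_tuple ltn_ord.
Qed.

Lemma sheet_pt_max s x : tnth (sheet_pt s x) ord_max = (-1) ^+ s * height x.
Proof. by rewrite (tnth_nth 0)/= nth_rcons size_tuple ltnn eqxx. Qed.

Lemma height_arg_ge1 (x : Rn) : 1 <= 1 + \sum_(i < n) tnth x i ^+ 2.
Proof. by rewrite lerDl sumr_ge0// => i _; exact: sqr_ge0. Qed.

Lemma sheet_ptP s x : lorentz_sq (sheet_pt s x) == -1.
Proof.
rewrite /lorentz_sq sheet_pt_max exprMn sqrr_sign mul1r sqr_sqrtr; last first.
  exact: le_trans (height_arg_ge1 x).
under eq_bigr do rewrite sheet_pt_widen.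
by rewrite opprD addrCA subrr addr0.
Qed.

(* Graph parametrization of the upper (s = false) and lower (s = true) sheet. *)
Definition sheet (s : bool) (x : Rn) : hyperboloid := Hyperboloid (sheet_ptP s x).

HB.instance Definition _ :=
  isPointed.Build hyperboloid (sheet false [tuple 0 | i < n]).

Let hyp_measurable : set (set hyperboloid) :=
  preimage_set_system setT hpt measurable.

Let hyp_sigma_algebra : sigma_algebra setT hyp_measurable.
Proof.
apply: sigma_algebra_preimage.
exact: sigma_algebra_measurable.
Qed.

Let hyp_measurable0 : hyp_measurable set0.
Proof. by have [] := hyp_sigma_algebra. Qed.

Let hyp_measurableC A : hyp_measurable A -> hyp_measurable (~` A).
Proof. by have [_ h _] := hyp_sigma_algebra => /h; rewrite setTD. Qed.

Let hyp_measurable_bigcup (F : (set hyperboloid)^nat) :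
  (forall i, hyp_measurable (F i)) -> hyp_measurable (\bigcup_i F i).
Proof. by have [_ _] := hyp_sigma_algebra; exact. Qed.

(* The sigma-algebra consists of the traces of the Borel sets of R^(n+1). *)
HB.instance Definition _ := @isMeasurable.Build (preimage_display hpt)
  hyperboloid hyp_measurable hyp_measurable0 hyp_measurableC
  hyp_measurable_bigcup.

Lemma measurable_height : measurable_fun setT height.
Proof.
have -> : height =
    Num.sqrt \o (fun x : Rn => 1 + \sum_(i < n) tnth x i ^+ 2) by [].
apply: measurableT_comp => //.
  by apply: continuous_measurable_fun; exact: sqrt_continuous.
apply: measurable_funD => //.
apply: measurable_sum => i.
apply: measurable_funX.
exact: measurable_tnth.
Qed.

Lemma measurable_sheet s : measurable_fun setT (sheet s).
Proof.
have mpt : measurable_fun setT (sheet_pt s).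
  apply/measurable_fun_tnthP => i.
  have [ilt|ige] := ltnP i n.
    have -> : i = widen_ord (leqnSn n) (Ordinal ilt) by exact/val_inj.
    rewrite (_ : _ \o _ = @tnth _ _ ^~ (Ordinal ilt)); first exact: measurable_tnth.
    by apply/funext => x /=; rewrite sheet_pt_widen.
  have -> : i = ord_max by apply/val_inj/eqP; rewrite eqn_leq -ltnS ltn_ord.
  rewrite (_ : _ \o _ = fun x => (-1) ^+ s * height x).
    by apply: measurable_funM => //; exact: measurable_height.
  by apply/funext => x /=; rewrite sheet_pt_max.
move=> _ _ [B mB <-]; rewrite setTI.
by have := mpt measurableT _ mB; rewrite !setTI.
Qed.

(* dq_1 ... dq_n / |q_(n+1)| on each sheet, pulled back to R^n by sheet s. *)
Definition hyp_measure_fun (A : set hyperboloid) : \bar R :=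
  (\sum_(s : bool)
    \int[lebesgue_measure_tuple R n]_(x in sheet s @^-1` A)
      (`|tnth (sheet s x) ord_max|^-1)%:E)%E.

Let norm_sheet s x : `|tnth (sheet s x) ord_max| = height x.
Proof.
by rewrite sheet_pt_max normrM normr_sign mul1r ger0_norm// sqrtr_ge0.
Qed.

Let height_ge1 x : 1 <= height x.
Proof. by rewrite -[leLHS]sqrtr1 ler_wsqrtr// height_arg_ge1. Qed.

Let msheet s A : measurable A -> measurable (sheet s @^-1` A).
Proof. by move=> mA; rewrite -[X in measurable X]setTI; exact: measurable_sheet. Qed.

Let mdensity D s :
  measurable_fun D (fun x : Rn => (`|tnth (sheet s x) ord_max|^-1)%:E).
Proof.
apply/measurable_EFinP; apply: measurable_funTS.
rewrite (_ : (fun _ => _) = @powR R ^~ (-1) \o height).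
  by apply: measurableT_comp; [exact: measurable_powR|exact: measurable_height].
by apply/funext => x; rewrite /= norm_sheet powR_inv1// sqrtr_ge0.
Qed.

Let hyp_measure0 : hyp_measure_fun set0 = 0%E.
Proof.
by rewrite /hyp_measure_fun big1// => s _; rewrite preimage_set0 integral_set0.
Qed.

Let hyp_measure_ge0 A : (0 <= hyp_measure_fun A)%E.
Proof.
apply: sume_ge0 => s _; apply: integral_ge0 => x _.
by rewrite lee_fin invr_ge0.
Qed.

Let hyp_measure_sigma_additive : semi_sigma_additive hyp_measure_fun.
Proof.
move=> F mF tF mUF; rewrite /hyp_measure_fun big_bool/=.
rewrite (_ : (fun k => _) = (fun k =>
    \sum_(0 <= i < k) \int[lebesgue_measure_tuple R n]_(x in sheet true @^-1` F i)
      (`|tnth (sheet true x) ord_max|^-1)%:E +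
    \sum_(0 <= i < k) \int[lebesgue_measure_tuple R n]_(x in sheet false @^-1` F i)
      (`|tnth (sheet false x) ord_max|^-1)%:E)%E); last first.
  by apply/funext => k; rewrite -big_split/=; apply: eq_bigr => i _; rewrite big_bool.
have d0 s x : (0 <= (`|tnth (sheet s x) ord_max|^-1)%:E :> \bar R)%E.
  by rewrite lee_fin invr_ge0.
apply: cvgeD.
- by apply: ge0_adde_def; rewrite inE; apply: integral_ge0 => x _; exact: d0.
- rewrite preimage_bigcup; apply: semi_sigma_additive_nng_induced => //.
  + by move=> i; exact: msheet.
  + apply/trivIsetP => /= i j _ _ ij; rewrite -preimage_setI.
    by move/trivIsetP : tF => /(_ _ _ _ _ ij) ->//; rewrite preimage_set0.
  + by rewrite -preimage_bigcup; exact: msheet.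
- rewrite preimage_bigcup; apply: semi_sigma_additive_nng_induced => //.
  + by move=> i; exact: msheet.
  + apply/trivIsetP => /= i j _ _ ij; rewrite -preimage_setI.
    by move/trivIsetP : tF => /(_ _ _ _ _ ij) ->//; rewrite preimage_set0.
  + by rewrite -preimage_bigcup; exact: msheet.
Qed.

HB.instance Definition _ := isMeasure.Build _ _ _ hyp_measure_fun
  hyp_measure0 hyp_measure_ge0 hyp_measure_sigma_additive.

Let hyp_measure_sigma_finite : sigma_finite setT hyp_measure_fun.
Proof.
have /sigma_finiteP[G [TG ndG Goo]] := sigma_finiteT (lebesgue_measure_tuple R n).
pose pr (q : Rn1) : Rn := [tuple tnth q (widen_ord (leqnSn n) i) | i < n].
have mpr : measurable_fun setT pr.
  apply/measurable_fun_tnthP => i.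
  rewrite (_ : _ \o _ = @tnth _ _ ^~ (widen_ord (leqnSn n) i)).
    exact: measurable_tnth.
  by apply/funext => q /=; rewrite tnth_mktuple.
have prK s x : pr (sheet s x) = x.
  by apply/eq_from_tnth => i; rewrite tnth_mktuple sheet_pt_widen.
have mG k : measurable (G k) by have [] := Goo k.
exists (fun k => [set q : hyperboloid | G k (pr q)]).
  apply/seteqP; split=> // q _.
  by have : (\bigcup_k G k) (pr q) by rewrite -TG.
move=> k; split.
  exists (pr @^-1` G k); last by rewrite setTI.
  by have := mpr measurableT _ (mG k); rewrite setTI.
rewrite /hyp_measure_fun big_bool/=.
suff h s : (\int[lebesgue_measure_tuple R n]_(x in
    sheet s @^-1` [set q : hyperboloid | G k (pr q)])
      (`|tnth (sheet s x) ord_max|^-1)%:E < +oo)%E by exact: lte_add_pinfty.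
rewrite (_ : _ @^-1` _ = G k); last first.
  by apply/seteqP; split=> x /=; rewrite -/(sheet s x) prK.
apply: (@le_lt_trans _ _ (\int[lebesgue_measure_tuple R n]_(x in G k) 1)%E).
  apply: ge0_le_integral => //.
  by move=> x _; rewrite lee_fin norm_sheet invf_le1 ?height_ge1// (lt_le_trans _ (height_ge1 x)).
by rewrite integral_cst// mul1e; have [] := Goo k.
Qed.

HB.instance Definition _ := Measure_isSigmaFinite.Build _ _ _
  hyp_measure_fun hyp_measure_sigma_finite.

Definition hyp_measure : {sigma_finite_measure set hyperboloid -> \bar R} :=
  hyp_measure_fun.

End hyperboloid.

(* The j-th column of the matrix is the point q_j. *)
Definition hyp_det (R : realType) (n : nat)
    (q : n.+1.-tuple (hyperboloid R n)) : R :=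
  `|\det (\matrix_(i < n.+1, j < n.+1) (tnth (hpt (tnth q j)) i : R))|.

(* Main.v *)
Require Import Defs.
From mathcomp Require Import all_boot all_order all_algebra.
From mathcomp Require Import all_classical all_reals all_analysis.
From mathcomp Require Import ess_sup_inf measurable_realfun.
From mathcomp Require Import perm ring lra.

(** Put [D = n + 1], [g_j = F_j ^ (p / D)] and [x_j(q) = g_j(q) q], a vector of
    [R^D]. Absorbing the weights into the columns of the determinant, the
    functional under the supremum is
    [|det (x_1(q_1), ..., x_D(q_D))| ^ (D / p)], while the [p]th power of the
    norm of [F_j] is the integral of [g_j ^ D]. In the polar coordinates
    [dx = r ^ n dr dnu(q)] of the cone over the hyperboloid, the latter is [D]
    times the volume of the union [K_j] of the segments from [0] to [x_j(q)].
    Hence the theorem is an instance of an inequality for [D] subsets of [R^D]: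
    the product of their volumes is at most a constant times the [D]th power of
    the supremum of [|det (x_1, ..., x_D)|] over [x_j] in [K_j].

    Three facts prove this inequality. First, if the vectors [x_1, ..., x_D] of
    one set [K] form a frame whose determinant is within a factor [2] of the
    largest possible one, then Cramer's rule puts [K] into the parallelepiped of
    the combinations of these vectors with coefficients in [-2, 2]
    ([near_max_frame]). Second, the volume of that parallelepiped is a constant
    times the determinant of the frame; read in polar coordinates this bounds
    the integral of [g ^ D] ([ge0_integral_cone_le]). It then remains to compare
    [D] frames with the determinants obtained by picking one vector out of each,
    and this is the third fact, of pure linear algebra ([transversal_det]): it
    follows by induction on [D] from the identity [det (adj X) = (det X) ^ n],
    which plays the part of the Loomis-Whitney inequality.

    The supremum being an essential one, the determinants are bounded only for
    almost all tuples. Outside a negligible set the values of [x_j] are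
    essential, in the sense that each neighbourhood of them is visited on a set
    of positive measure, and at such points the bound holds by continuity
    ([ae_det_le_pointwise]). *)

Set Implicit Arguments.
Unset Strict Implicit.
Unset Printing Implicit Defensive.
Import Order.TTheory GRing.Theory Num.Theory.
Import numFieldNormedType.Exports.

Local Open Scope classical_set_scope.
Local Open Scope ring_scope.

(** * Determinants *)

Lemma norm_det_le (R : numDomainType) (D : nat) (X : 'M[R]_D) (b : 'I_D -> R) :
  (forall i j, `|X i j| <= b i) -> `|\det X| <= D`!%:R * \prod_i b i.
Proof.
move=> Xb; rewrite /determinant (le_trans (ler_norm_sum _ _ _))//.
rewrite (@le_trans _ _ (\sum_(s : 'S_D) \prod_i b i))//.
  apply: ler_sum => s _; rewrite normrM normr_sign mul1r normr_prod.
  by apply: ler_prod => i _; rewrite normr_ge0 Xb.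
by rewrite sumr_const cardT -cardE card_Sn mulr_natl.
Qed.

Lemma norm_cofactor (R : numDomainType) (n : nat) (X : 'M[R]_n) i j :
  `|cofactor X i j| = `|\det (row' i (col' j X))|.
Proof. by rewrite normrM normrX normrN1 expr1n mul1r. Qed.

(** The adjugate has determinant [(\det X) ^+ n], so that its entries cannot all
    be small. They are the minors of [X], which makes this a discrete
    Loomis-Whitney inequality: the shadows of a parallelepiped on the coordinate
    hyperplanes control its volume, each shadow being spanned by [n] of the
    [n.+1] edges. *)
Lemma norm_det_adj_le (R : realFieldType) (n : nat) (X : 'M[R]_n.+1) :
  \det X != 0 -> exists b : 'I_n.+1 -> 'I_n.+1,
    `|\det X| ^+ n
      <= n.+1`!%:R * \prod_m `|\det (row' m (col' (b m) X))|.
Proof.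
move=> X0.
pose b m := [arg max_(k > ord0) `|\det (row' m (col' k X))|]%O.
exists b.
have -> : `|\det X| ^+ n = `|\det (\adj X)^T|.
  rewrite det_tr -normrX; congr (`|_|); apply: (mulfI X0).
  by rewrite -det_mulmx mul_mx_adj det_scalar exprS.
apply: norm_det_le => i j; rewrite !mxE norm_cofactor /b.
by case: arg_maxP => //= k _; apply.
Qed.

(** The theorem for parallelepipeds: some choice of one edge out of each of [D]
    parallelepipeds spans at least a constant times the geometric mean of their
    volumes. After a linear change of variables the first one is the unit cube.
    Taking its edge [e_m] reduces the determinant to that of the shadows of the
    other ones along [e_m], so that by induction it suffices to find one
    direction [m] in which these shadows are large simultaneously. Multiplying
    the Loomis-Whitney inequalities of all the parallelepipeds shows that a best
    [m] will do: the geometric mean over [m] of the products of the shadows is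
    already large. *)
Lemma transversal_det (R : realFieldType) (D : nat) :
  exists2 C : R, 1 <= C & forall X : 'I_D -> 'M[R]_D,
    exists c : 'I_D -> 'I_D,
      \prod_i `|\det (X i)|
        <= C * `|\det (\matrix_(i, j) X j i (c j))| ^+ D.
Proof.
elim: D => [|n [C C1 IH]].
  by exists 1 => // X; exists id; rewrite big_ord0 expr0 mulr1.
pose K : R := n.+1`!%:R ^+ n * C ^+ n.+1.
have fact1 : 1 <= n.+1`!%:R :> R by rewrite ler1n fact_gt0.
have K1 : 1 <= K by rewrite mulr_ege1// exprn_ege1.
exists K => // X.
have [[i Xi0]|X0] := pselect (exists i, \det (X i) = 0).
  exists id; rewrite (bigD1 i)//= Xi0 normr0 mul0r mulr_ge0//.
  exact: le_trans K1.
have {}X0 i : \det (X i) != 0 by apply/eqP => Xi0; apply: X0; exists i.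
pose A := X ord0; have Au : A \in unitmx by rewrite unitmxE unitfE X0.
have A0 : 0 < `|\det A| by rewrite normr_gt0 X0.
pose Z (i : 'I_n) := invmx A *m X (lift ord0 i).
have detX i : \det (X (lift ord0 i)) = \det A * \det (Z i).
  by rewrite -det_mulmx mulKVmx.
have Z0 i : \det (Z i) != 0.
  by have := X0 (lift ord0 i); rewrite detX mulf_eq0 negb_or => /andP[].
have [b Hb] := choice (fun i => norm_det_adj_le (Z0 i)).
pose t m := \prod_i `|\det (row' m (col' (b i m) (Z i)))|.
have t0 m : 0 <= t m by apply: prodr_ge0.
pose m := [arg max_(k > ord0) t k]%O.
have tm k : t k <= t m by rewrite /m; case: arg_maxP => //= l _; apply.
have Ht : (\prod_i `|\det (Z i)|) ^+ n <= n.+1`!%:R ^+ n * t m ^+ n.+1.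
  rewrite -prodrXl (@le_trans _ _ (\prod_(i < n) (n.+1`!%:R
      * \prod_k `|\det (row' k (col' (b i k) (Z i)))|)))//.
    by apply: ler_prod => i _; rewrite exprn_ge0//= Hb.
  rewrite big_split/= prodr_const card_ord exchange_big/=.
  rewrite ler_wpM2l// ?exprn_ge0//.
  rewrite -[X in _ ^+ X]card_ord -prodr_const.
  by apply: ler_prod => k _; rewrite t0 tm.
have [c Hc] := IH (fun i => row' m (col' (b i m) (Z i))).
pose W := \matrix_(i, j) (row' m (col' (b j m) (Z j))) i (c j).
pose c' (i : 'I_n.+1) :=
  if unlift ord0 i is Some i' then lift (b i' m) (c i') else m.
pose T := \matrix_(i, j) X j i (c' j).
(* In the basis [A] the column of [T] taken from [A] is the basis vector of
   index [m], and expanding along it leaves the transversal [W] of the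
   shadows. *)
have detT : `|\det T| = `|\det A| * `|\det W|.
  have -> : T = A *m \matrix_(i, j) (invmx A *m X j) i (c' j).
    apply/matrixP => i j; rewrite !mxE.
    under eq_bigr do rewrite mxE.
    have /matrixP/(_ i (c' j)) := mulKVmx Au (X j).
    by rewrite mxE => <-.
  rewrite det_mulmx normrM; congr (_ * _).
  rewrite (expand_det_col _ ord0) (bigD1 m)//= big1 ?addr0; last first.
    move=> i im; rewrite mxE /c' unlift_none -/A mulVmx// mxE (negbTE im).
    by rewrite mul0r.
  rewrite mxE /c' unlift_none -/A mulVmx// mxE eqxx mul1r norm_cofactor.
  congr (`| \det _ |); apply/matrixP => i j.
  by rewrite !mxE /c' liftK.
exists c'; rewrite -/T big_ord_recl -/A detT exprMn.
under eq_bigr do rewrite detX normrM.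
rewrite big_split/= prodr_const card_ord mulrA -exprS mulrCA.
rewrite ler_wpM2l ?exprn_ge0//.
case: (posnP n) => [n0|n0].
  have -> : \prod_(i < n) `|\det (Z i)| = 1.
    by move: {+}(Z); rewrite n0 => Z'; rewrite big_ord0.
  have -> : `|\det W| = 1.
    by move: {+}(W); rewrite n0 => W'; rewrite det_mx00 normr1.
  by rewrite expr1n mulr1.
(* What is known bounds an [n]th power, hence the comparison of [n]th powers. *)
rewrite -(@ler_pXn2r _ n)// ?nnegrE ?prodr_ge0//; last first.
  by rewrite mulr_ge0 ?exprn_ge0// (le_trans _ K1).
apply: (le_trans Ht); rewrite exprMn -exprM mulnC.
have W0 : 0 <= `|\det W| ^+ n by rewrite exprn_ge0.
apply: (@le_trans _ _ (n.+1`!%:R ^+ n * (C * `|\det W| ^+ n) ^+ n.+1)).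
  rewrite ler_wpM2l ?exprn_ge0// lerXn2r ?nnegrE//.
  by rewrite mulr_ge0// (le_trans _ C1).
rewrite exprMn mulrA -/K -exprM ler_wpM2r ?exprn_ge0//.
by rewrite -[leLHS]expr1 ler_weXn2l.
Qed.

Lemma det_replace_col (F : fieldType) (n : nat) (X : 'M[F]_n) (x : 'cV[F]_n) k :
  \det X != 0 ->
  \det (\matrix_(i, j) if j == k then x i 0 else X i j)
    = \det X * (invmx X *m x) k 0.
Proof.
move=> X0; have Xu : X \in unitmx by rewrite unitmxE unitfE.
rewrite /invmx Xu -scalemxAl mxE mulrA divff// mul1r mxE.
rewrite (expand_det_col _ k); apply: eq_bigr => i _.
rewrite !mxE eqxx mulrC; congr (_ * _); rewrite /cofactor; congr (_ * \det _).
by apply/matrixP => a b; rewrite !mxE eq_sym (negbTE (neq_lift _ _)).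
Qed.

(** Replacing the [k]th column of a frame [X] by [x] multiplies its determinant
    by the [k]th coordinate of [x] in this frame. If [X] comes within a factor
    [2] of the largest determinant, all coordinates of points of [K] are
    therefore at most [2] in absolute value. *)
Lemma near_max_frame (R : realType) (D : nat) (K : set 'cV[R]_D) (B : R) :
  (forall X : 'M[R]_D, (forall j, K (col j X)) -> `|\det X| <= B) ->
  (exists2 X : 'M[R]_D, (forall j, K (col j X)) & \det X != 0) ->
  exists X : 'M[R]_D, [/\ (forall j, K (col j X)), \det X != 0 &
    forall x, K x -> forall k, `|(invmx X *m x) k 0| <= 2].
Proof.
move=> KB [X0 KX0 dX0].
pose S := [set `|\det X| | X in [set X : 'M[R]_D | forall j, K (col j X)]].
have hS : has_sup S.
  split; first by exists `|\det X0|, X0.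
  by exists B => _ [X KX <-]; exact: KB.
have S0 : 0 < sup S.
  apply: (@lt_le_trans _ _ `|\det X0|); first by rewrite normr_gt0.
  by apply: ub_le_sup; [exact: hS.2|exists X0].
have e0 : 0 < sup S / 2 by rewrite divr_gt0.
have [_ [X KX <-] Xsup] := sup_adherent e0 hS.
have dX : 0 < `|\det X|.
  by apply: lt_trans Xsup; rewrite {1}(splitr (sup S)) addrK.
exists X; split => //; first by rewrite -normr_gt0.
move=> x Kx k.
rewrite -(ler_pM2l dX) -normrM -det_replace_col -?normr_gt0//.
apply: (@le_trans _ _ (sup S)).
  apply: ub_le_sup; first exact: hS.2.
  eexists; last reflexivity.
  move=> j /=; have [jk|jk] := eqVneq j k.
    by rewrite (_ : col _ _ = x)//; apply/colP => i; rewrite !mxE jk eqxx.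
  rewrite (_ : col _ _ = col j X)//.
  by apply/colP => i; rewrite !mxE (negbTE jk).
rewrite -ler_pdivrMr//; apply: ltW; apply: le_lt_trans Xsup.
by rewrite {2}(splitr (sup S)) addrK.
Qed.

(** Elimination of the [l]th unknown. Choosing the largest entry of the column
    as pivot makes all multipliers at most [1], so that eliminating at most
    doubles the bound on the linear forms. *)
Lemma pivot_elimination (R : realFieldType) (n : nat) (Y : 'M[R]_n.+1)
  (l : 'I_n.+1) :
  \det Y != 0 -> exists k (Z : 'M[R]_n),
  [/\ Y k l != 0, `|\det Y| = `|Y k l| * `|\det Z| &
  forall (x : 'I_n.+1 -> R) (a : R), (forall i, `|\sum_j Y i j * x j| <= a) ->
    forall i, `|\sum_j Z i j * x (lift l j)| <= 2 * a].
Proof.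
move=> Y0.
pose k := [arg max_(k > ord0) `|Y k l|]%O.
have Yk i : `|Y i l| <= `|Y k l|.
  by rewrite /k; case: arg_maxP => //= m _; apply.
have Ykl0 : Y k l != 0.
  apply: contra Y0 => /eqP Ykl; rewrite (expand_det_col _ l) big1// => i _.
  have := Yk i; rewrite Ykl normr0 normr_le0 => /eqP ->.
  by rewrite mul0r.
pose v i := if i == k then 0 else Y i l / Y k l.
pose L : 'M[R]_n.+1 := \matrix_(i, j) ((i == j)%:R - v i * (j == k)%:R).
pose T := L *m Y.
have TE i j : T i j = Y i j - v i * Y k j.
  have sumd a (f : 'I_n.+1 -> R) : \sum_m (m == a)%:R * f m = f a.
    rewrite (bigD1 a)//= eqxx mul1r big1 ?addr0// => m /negbTE ->.
    by rewrite mul0r.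
  rewrite !mxE -(sumd i (Y^~ j)) -(sumd k (Y^~ j)) mulr_sumr -sumrB.
  by apply: eq_bigr => m _; rewrite !mxE mulrBl mulrA eq_sym.
have detL : \det L = 1.
  rewrite (expand_det_row _ k) (bigD1 k)//= big1 ?addr0; last first.
    by move=> j jk; rewrite mxE /v eqxx mul0r subr0 eq_sym (negbTE jk) mul0r.
  rewrite mxE /v !eqxx mul0r subr0 mul1r /cofactor -signr_odd addnn odd_double
    expr0 mul1r.
  rewrite (_ : row' _ _ = 1%:M) ?det1//; apply/matrixP => i j.
  rewrite !mxE (inj_eq lift_inj) [lift k j == k]eq_sym (negbTE (neq_lift _ _)).
  by rewrite mulr0 subr0.
exists k, (row' k (col' l T)); split => //.
  rewrite -[\det Y]mul1r -detL -det_mulmx -/T (expand_det_col _ l) (bigD1 k)//=.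
  rewrite big1 ?addr0; last first.
    by move=> i ik; rewrite TE /v (negbTE ik) divfK// subrr mul0r.
  by rewrite TE /v eqxx mul0r subr0 normrM norm_cofactor.
move=> x a Ha i.
have vle : `|v (lift k i)| <= 1.
  rewrite /v eq_sym (negbTE (neq_lift _ _))
    normrM normfV ler_pdivrMr ?normr_gt0//.
  by rewrite mul1r.
have -> : \sum_j (row' k (col' l T)) i j * x (lift l j) =
    \sum_j Y (lift k i) j * x j - v (lift k i) * \sum_j Y k j * x j.
  rewrite mulr_sumr -sumrB (bigD1_ord l)//=.
  rewrite /v eq_sym (negbTE (neq_lift _ _)) mulrA divfK// subrr add0r.
  apply: eq_bigr => j _; rewrite !mxE -[\sum_(_ < _) _]/(_ _).
  have := TE (lift k i) (lift l j); rewrite mxE => ->.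
  by rewrite /v eq_sym (negbTE (neq_lift _ _)) mulrBl mulrA.
rewrite (le_trans (ler_normB _ _))// mulr2n mulrDl mul1r lerD// normrM.
by rewrite -[leRHS]mul1r ler_pM.
Qed.

(** * Integration over tuples and volumes of parallelepipeds *)

Section tuple_integration.
Local Open Scope ereal_scope.

Lemma measurable_slabs d (T : measurableType d) (R : realType) (I : finType)
    (f : I -> T -> R) (a : R) : (forall i, measurable_fun setT (f i)) ->
  measurable [set x | forall i, (`|f i x| <= a)%R].
Proof.
move=> mf; rewrite (_ : [set _ | _] =
    \bigcap_(i in [set: I]) ((fun x => `|f i x|%R) @^-1` `]-oo, a]%classic)).
  apply: fin_bigcap_measurable => // i _.
  rewrite -[X in measurable X]setTI.
  by apply: measurableT_comp => //; exact: measurable_itv.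
apply/seteqP; split=> x /=.
  by move=> h i _; rewrite /= in_itv/=.
by move=> h i; have := h i Logic.I; rewrite /= in_itv/=.
Qed.

Lemma ge0_integral_tuple_cons d (T : measurableType d) (R : realType)
    (mu : {sigma_finite_measure set T -> \bar R}) n
    (f : n.+1.-tuple T -> \bar R) :
  measurable_fun setT f -> (forall x, 0 <= f x) ->
  \int[tuple_measure mu n.+1]_x f x =
  \int[mu]_x \int[tuple_measure mu n]_t f (tuple_cons (x, t)).
Proof.
move=> mf f0 /=; rewrite ge0_integral_pushforward//=; last first.
  exact: measurable_tuple_cons.
rewrite preimage_setT fubini_tonelli1//.
by apply: measurableT_comp => //; exact: measurable_tuple_cons.
Qed.

Lemma ge0_integral_tuple_cons2 d (T : measurableType d) (R : realType)
    (mu : {sigma_finite_measure set T -> \bar R}) n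
    (f : n.+1.-tuple T -> \bar R) :
  measurable_fun setT f -> (forall x, 0 <= f x) ->
  \int[tuple_measure mu n.+1]_x f x =
  \int[tuple_measure mu n]_t \int[mu]_x f (tuple_cons (x, t)).
Proof.
move=> mf f0; rewrite ge0_integral_tuple_cons//.
apply: (fubini_tonelli (f \o @tuple_cons _ _ _)); last by move=> x; exact: f0.
by apply: measurableT_comp => //; exact: measurable_tuple_cons.
Qed.

Lemma lebesgue_measure_slab (R : realType) (a b c : R) :
  b != 0%R -> (0 <= a)%R ->
  lebesgue_measure [set x : R | (`|b * x + c| <= a)%R] = (2 * a / `|b|)%:E.
Proof.
move=> b0 a0.
have nb0 : (0 < `|b|)%R by rewrite normr_gt0.
rewrite (_ : [set x | _] = `[(- c / b - a / `|b|),
  (- c / b + a / `|b|)]%classic)%R.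
  rewrite lebesgue_measure_itv/= lte_fin.
  case: ifPn => [_|]; first by rewrite -EFinB; congr (_%:E); lra.
  rewrite -leNgt => h; congr (_%:E).
  have : (0 <= a / `|b|)%R by rewrite divr_ge0.
  by lra.
apply/funext => x /=; apply/propext; rewrite in_itv/=.
have -> : (b * x + c = b * (x - - c / b))%R by field.
by rewrite normrM [(`|b| * _)%R]mulrC -ler_pdivlMr// ler_distl.
Qed.

Lemma measurable_linear_form (R : realType) n m (Y : 'I_m -> R)
  (s : 'I_m -> 'I_n) :
  measurable_fun setT (fun x : n.-tuple (measurableTypeR R) =>
    (\sum_j Y j * tnth x (s j) : R)%R).
Proof.
apply: measurable_sum => j; apply: measurable_funM => //.
exact: measurable_tnth.
Qed.

(** By induction on the dimension, with Tonelli in place of a linear change of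
    variables: once the first unknown has been eliminated by means of row [k],
    the other unknowns range over a parallelepiped of dimension [n], and above
    each of them row [k] leaves an interval of length [2 * a / `|Y k ord0|]. *)
Lemma volume_parallelepiped_le (R : realType) n : exists2 C : R, (0 <= C)%R &
  forall (Y : 'M[R]_n) (a : R), (\det Y != 0)%R -> (0 <= a)%R ->
  lebesgue_measure_tuple R n
    [set x | forall i, (`|\sum_j Y i j * (tnth x j : R)| <= a)%R]
  <= (C * a ^+ n / `|\det Y|)%:E.
Proof.
elim: n => [|n [C C0 IH]].
  exists 1%R => // Y a _ a0.
  rewrite det_mx00 normr1 expr0 !mul1r invr1 /lebesgue_measure_tuple/=
    /tuple_dirac.
  by rewrite diracE lee_fin lern1 leq_b1.
exists (2 * C * 2 ^+ n)%R; first by rewrite !mulr_ge0// exprn_ge0.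
move=> Y a Y0 a0.
have [k [Z [Yk0 dY HZ]]] := pivot_elimination ord0 Y0.
have Z0 : (\det Z != 0)%R.
  by move: Y0; rewrite -normr_eq0 dY mulf_eq0 negb_or !normr_eq0 => /andP[].
have b0 : (0 <= 2 * a)%R by rewrite mulr_ge0.
pose A : set (n.+1.-tuple (measurableTypeR R)) :=
  [set x | forall i, (`|\sum_j Y i j * (tnth x j : R)| <= a)%R].
pose Q : set (n.-tuple (measurableTypeR R)) :=
  [set x | forall i, (`|\sum_j Z i j * (tnth x j : R)| <= 2 * a)%R].
have mA : measurable A.
  by apply: measurable_slabs => i; exact: (measurable_linear_form (Y i) id).
have mQ : measurable Q.
  by apply: measurable_slabs => i; exact: (measurable_linear_form (Z i) id).
rewrite -/A -[A]setIT -integral_indic//.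
rewrite (@ge0_integral_tuple_cons2 _ _ _ _ n (fun x => (\1_A x)%:E))//;
  last first.
  exact/measurable_EFinP/measurable_indic.
apply: (@le_trans _ _ (\int[lebesgue_measure_tuple R n]_t
   ((2 * a / `|Y k ord0|)%:E * (\1_Q t)%:E))).
  apply: ge0_le_integral => //.
  - by move=> t _; apply: integral_ge0 => x _; rewrite lee_fin.
  - apply: (measurable_fun_fubini_tonelli_G
      ((fun x => (\1_A x)%:E) \o @tuple_cons _ _ _)).
      apply: measurableT_comp; last exact: measurable_tuple_cons.
      exact/measurable_EFinP/measurable_indic.
    by move=> x; rewrite lee_fin.
  - apply: measurable_funeM; exact/measurable_EFinP/measurable_indic.
  - move=> t _.
    pose c := (\sum_j Y k (lift ord0 j) * (tnth t j : R))%R.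
    have mS : measurable
        [set x : measurableTypeR R | (`|Y k ord0 * x + c| <= a)%R].
      rewrite (_ : [set _ | _] = [set x : measurableTypeR R |
          forall i : unit, (`|Y k ord0 * x + c| <= a)%R]).
        apply: (@measurable_slabs _ _ _ _ (fun _ (x : measurableTypeR R) =>
          Y k ord0 * x + c)%R) => _.
        exact: measurable_funD.
      by apply/seteqP; split => x /=; [move=> h _|move/(_ tt)].
    have m1 : measurable_fun [set: measurableTypeR R]
        (fun x : measurableTypeR R => \1_A (tuple_cons (x, t)) : R).
      have mc : measurable_fun [set: measurableTypeR R]
          (fun x : measurableTypeR R => tuple_cons (x, t)).
        apply: measurableT_comp; first exact: measurable_tuple_cons.
        exact: measurable_fun_pair.
      by apply: measurableT_comp; [exact: measurable_indic|exact: mc].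
    rewrite -(lebesgue_measure_slab c Yk0 a0).
    rewrite -[X in lebesgue_measure X]setIT -integral_indic//
      -ge0_integralZr//; last first.
      exact/measurable_EFinP/measurable_indic.
    apply: ge0_le_integral => //.
    - by apply/measurable_EFinP; exact: m1.
    - apply: emeasurable_funM => //; exact/measurable_EFinP/measurable_indic.
    move=> x _; rewrite muleC -EFinM lee_fin.
    have [Ax|nAx] := pselect (A (tuple_cons (x, t))); last first.
      by rewrite [leLHS]indicE memNset ?mulr_ge0.
    have Qt : Q t.
      move=> i; have := HZ (tnth (tuple_cons (x, t))) a Ax i.
      by under eq_bigr do rewrite tnthS.
    have Sx : (`|Y k ord0 * x + c| <= a)%R.
      have := Ax k; rewrite big_ord_recl/= /c.
      by under eq_bigr do rewrite tnthS.
    by rewrite !indicE !mem_set// mulr1.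
rewrite ge0_integralZl//; last 2 first.
- exact/measurable_EFinP/measurable_indic.
- by rewrite lee_fin divr_ge0.
rewrite integral_indic// setIT.
apply: (le_trans (lee_wpmul2l _ (IH Z _ Z0 b0)));
  first by rewrite lee_fin divr_ge0.
rewrite -EFinM lee_fin dY exprMn exprS le_eqVlt; apply/orP; left; apply/eqP.
by field; rewrite !normr_eq0 Yk0 Z0.
Qed.

End tuple_integration.

(** * Dilations of the Lebesgue measure *)

Section scaling.
Local Open Scope ereal_scope.

Lemma ge0_integral_lebesgue_scale (R : realType) (r : R)
    (f : measurableTypeR R -> \bar R) :
  (0 < r)%R -> measurable_fun setT f -> (forall x, 0 <= f x) ->
  r%:E * \int[@lebesgue_measure R]_x f (r * x)%R
  = \int[@lebesgue_measure R]_x f x.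
Proof.
move=> r0 mf f0.
have ms : measurable_fun [set: measurableTypeR R]
    (fun x : measurableTypeR R => (r * x)%R : measurableTypeR R).
  exact: mulrl_measurable.
have [m mE] : exists m : {measure set (measurableTypeR R) -> \bar R},
    (m : set _ -> \bar R) = pushforward (@lebesgue_measure R)
      (fun x : measurableTypeR R => (r * x)%R : measurableTypeR R).
  by unshelve eexists (pushforward (@lebesgue_measure R)
      (fun x : measurableTypeR R => (r * x)%R : measurableTypeR R)
        : {measure set _ -> \bar R}).
have -> : \int[@lebesgue_measure R]_x f (r * x)%R = \int[m]_x f x.
  rewrite [RHS](eq_measure_integral (pushforward (@lebesgue_measure R)
      (fun x : measurableTypeR R => (r * x)%R : measurableTypeR R))) ?mE//.
  by rewrite ge0_integral_pushforward.
rewrite -(@ge0_integral_mscale _ _ _ m _ measurableT (NngNum (ltW r0)))//.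
apply: eq_measure_integral => A mA _; apply/esym;
  apply: lebesgue_measure_unique => // X.
move=> [[a b] _ <-] /=.
rewrite /mscale/= mE /pushforward.
rewrite (_ : _ @^-1` _ = `](a / r)%R, (b / r)%R]%classic); last first.
  apply/seteqP; split => x /=; rewrite !in_itv/=.
    by rewrite ltr_pdivrMr// ler_pdivlMr// mulrC.
  by rewrite ltr_pdivrMr// ler_pdivlMr// mulrC.
rewrite !lebesgue_measure_itv/= !lte_fin ltr_pM2r ?invr_gt0//.
case: ifPn => _; last by rewrite mule0.
by rewrite -!EFinB -EFinM -mulrBl mulrC divfK// gt_eqF.
Qed.

Definition scale_tuple (R : realType) n (r : R)
    (x : n.-tuple (measurableTypeR R)) : n.-tuple (measurableTypeR R) :=
  [tuple of map (fun u : R => r * u)%R x].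

Lemma tnth_scale_tuple (R : realType) n (r : R)
    (x : n.-tuple (measurableTypeR R)) i :
  tnth (scale_tuple r x) i = (r * tnth x i)%R.
Proof. by rewrite tnth_map. Qed.

Lemma measurable_scale_tuple (R : realType) n (r : R) :
  measurable_fun setT (@scale_tuple R n r).
Proof.
apply/measurable_fun_tnthP => i.
rewrite (_ : _ \o _ = fun x => (r * tnth x i : R)%R).
  by apply: measurable_funM => //; exact: measurable_tnth.
by apply/funext => x /=; rewrite tnth_scale_tuple.
Qed.

Lemma ge0_integral_scale_tuple (R : realType) n (r : R)
    (f : n.-tuple (measurableTypeR R) -> \bar R) :
  (0 < r)%R -> measurable_fun setT f -> (forall x, 0 <= f x) ->
  (r ^+ n)%:E * \int[lebesgue_measure_tuple R n]_x f (scale_tuple r x)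
  = \int[lebesgue_measure_tuple R n]_x f x.
Proof.
move=> r0; elim: n f => [|n IH] f mf f0.
  rewrite expr0 mul1e; congr integral; apply/funext => x.
  by congr f; apply/eq_from_tnth; case.
rewrite /lebesgue_measure_tuple.
rewrite ge0_integral_tuple_cons//; last first.
  by apply: measurableT_comp => //; exact: measurable_scale_tuple.
rewrite [RHS]ge0_integral_tuple_cons//.
have mfc : measurable_fun setT (f \o @tuple_cons _ _ n).
  by apply: measurableT_comp => //; exact: measurable_tuple_cons.
pose g (x : measurableTypeR R) :=
  \int[lebesgue_measure_tuple R n]_t f (tuple_cons (x, t)).
have mg : measurable_fun setT g.
  apply: (measurable_fun_fubini_tonelli_F (f \o @tuple_cons _ _ n)) => //.
  by move=> x; exact: f0.
have g0 x : 0 <= g x by exact: integral_ge0.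
rewrite -[RHS]/(\int[@lebesgue_measure R]_x g x)
  -(ge0_integral_lebesgue_scale r0 mg g0).
rewrite exprSr EFinM -muleA muleCA; congr (_ * _).
have mfs : measurable_fun setT (f \o scale_tuple r \o @tuple_cons _ _ n).
  apply: measurableT_comp; last exact: measurable_tuple_cons.
  by apply: measurableT_comp => //; exact: measurable_scale_tuple.
rewrite -ge0_integralZl//; last 3 first.
- apply: (measurable_fun_fubini_tonelli_F
    (f \o scale_tuple r \o @tuple_cons _ _ n)) => //.
  by move=> x; exact: f0.
- by move=> x _; exact: integral_ge0.
- by rewrite lee_fin exprn_ge0// ltW.
apply: eq_integral => x _.
have mfx : measurable_fun setT (fun t =>
  f (tuple_cons ((r * x)%R : measurableTypeR R, t))).
  exact: (measurableT_comp mfc (measurable_pair1 _)).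
rewrite /g -(IH (fun t => f (tuple_cons ((r * x)%R : measurableTypeR R, t))))//.
congr (_ * _); apply: eq_integral => t _; congr f; apply/eq_from_tnth => i.
rewrite tnth_scale_tuple; have [j ->|->] := unliftP ord0 i.
  by rewrite !tnthS tnth_scale_tuple.
by [].
Qed.

End scaling.

(** * Radial integrals *)

Lemma measurable_fun_sqrt d (T : measurableType d) (R : realType) (f : T -> R) :
  measurable_fun setT f -> measurable_fun setT (fun x => Num.sqrt (f x)).
Proof.
move=> mf; apply: (measurableT_comp (f := @Num.sqrt R)) => //.
by apply: continuous_measurable_fun; exact: sqrt_continuous.
Qed.

Lemma measurable_funV_ge0 d (T : measurableType d) (R : realType) (f : T -> R) :
  (forall x, 0 <= f x) ->
  measurable_fun setT f -> measurable_fun setT (fun x => (f x)^-1).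
Proof.
move=> f0 mf; rewrite (_ : (fun _ => _) = @powR R ^~ (-1) \o f).
  by apply: measurableT_comp => //; exact: measurable_powR.
by apply/funext => x /=; rewrite powR_inv1.
Qed.

Lemma measurable_radius (R : realType) (S : R) :
  measurable_fun setT (fun r : measurableTypeR R => Num.sqrt (r ^+ 2 + S) : R).
Proof.
by apply: measurable_fun_sqrt; apply: measurable_funD.
Qed.

Lemma radial_weight_le (R : realType) (S r t : R) :
  0 <= S -> 0 < r -> r <= t ->
  r / Num.sqrt (r ^+ 2 + S) <= t / Num.sqrt (t ^+ 2 + S).
Proof.
move=> S0 r0 rt; have t0 : 0 < t by apply: lt_le_trans rt.
have p (u : R) : 0 < u -> 0 < Num.sqrt (u ^+ 2 + S).
  by move=> u0; rewrite sqrtr_gt0 ltr_wpDr// exprn_gt0.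
rewrite ler_pdivrMr ?p// mulrAC ler_pdivlMr ?p//.
rewrite -(@ler_pXn2r _ 2)// ?nnegrE ?mulr_ge0 ?sqrtr_ge0 ?(ltW r0) ?(ltW t0)//.
rewrite !exprMn !sqr_sqrtr; [|by rewrite addr_ge0// sqr_ge0..].
have : r ^+ 2 <= t ^+ 2 by rewrite lerXn2r ?nnegrE ?(ltW r0) ?(ltW t0)//.
by nra.
Qed.

Lemma measurable_radial_set (R : realType) (a c w S : R) :
  measurable [set r : measurableTypeR R | 0 < r /\
    `|a * Num.sqrt (r ^+ 2 + S) + c| <= w].
Proof.
rewrite (_ : [set _ | _] = `]0, +oo[%classic `&`
  [set r : measurableTypeR R | forall i : unit,
    `|a * Num.sqrt (r ^+ 2 + S) + c| <= w]).
  apply: measurableI; first exact: measurable_itv.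
  apply: (@measurable_slabs _ _ _ _ (fun _ (r : measurableTypeR R) =>
    a * Num.sqrt (r ^+ 2 + S) + c)) => _.
  apply: measurable_funD => //; apply: measurable_funM => //.
  exact: measurable_radius.
by apply/seteqP; split => r /=; rewrite in_itv/= andbT => -[? H];
  split => //; exact: H tt.
Qed.

Lemma measurable_radial_slab (R : realType) (a c w S : R) :
  measurable_fun setT (fun r : measurableTypeR R =>
    (\1_[set r : measurableTypeR R | 0 < r /\
         `|a * Num.sqrt (r ^+ 2 + S) + c| <= w] r
     * (r / Num.sqrt (r ^+ 2 + S)))%:E).
Proof.
apply/measurable_EFinP; apply: measurable_funM.
  by apply: measurable_indic; exact: measurable_radial_set.
apply: measurable_funM => //.
apply: measurable_funV_ge0; first by move=> r; exact: sqrtr_ge0.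
exact: measurable_radius.
Qed.

(** The substitution [t = Num.sqrt (r ^+ 2 + S)] turns the measure into [dt] on
    an interval of length [2 * w / `|a|]. It is avoided at the cost of a factor
    [2]: on the corresponding interval from [r1] to [r2] the weight is at most
    its value at [r2], and [r2 * (r2 - r1) <= r2 ^+ 2 - r1 ^+ 2], which is at
    most the difference of the squares of the end values of [t]. *)
Lemma radial_slab (R : realType) (a c w S : R) : a != 0 -> 0 <= w -> 0 <= S ->
  (\int[@lebesgue_measure R]_r
    (\1_[set r : measurableTypeR R | (0 < r /\
         `|a * Num.sqrt (r ^+ 2 + S) + c| <= w)%R] r
     * (r / Num.sqrt (r ^+ 2 + S)))%R%:E <= (4 * w / `|a|)%R%:E)%E.
Proof.
move=> a0 w0 S0.
set A := [set r | _].
have na0 : 0 < `|a| by rewrite normr_gt0.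
have C0 : 0 <= 4 * w / `|a| by rewrite divr_ge0// mulr_ge0.
have [[u Au]|nA] := pselect (exists u, A u); last first.
  rewrite (_ : (fun _ => _) = cst 0%E) ?integral0 ?lee_fin//.
  apply/funext => r; rewrite indicE memNset ?mul0r// => Ar.
  by apply: nA; exists r.
pose al := - c / a - w / `|a|; pose be := - c / a + w / `|a|.
have bealE : be - al = 2 * (w / `|a|) by rewrite /be /al; ring.
have Ale r : A r -> [/\ 0 < r, al <= Num.sqrt (r ^+ 2 + S)
  & Num.sqrt (r ^+ 2 + S) <= be].
  move=> [r0].
  have -> : a * Num.sqrt (r ^+ 2 + S) + c =
      a * (Num.sqrt (r ^+ 2 + S) - (- c / a)).
    by field.
  by rewrite normrM mulrC -ler_pdivlMr// ler_distl => /andP[].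
have be0 : 0 < be.
  have [u0 _] := Ale _ Au; apply: lt_le_trans.
  by rewrite sqrtr_gt0 ltr_wpDr// exprn_gt0.
(* [al] may be negative, while the values of the square root are not. *)
pose al' := Num.max al 0.
pose r2 := Num.sqrt (be ^+ 2 - S); pose r1 := Num.sqrt (al' ^+ 2 - S).
have Ar12 r : A r -> r1 <= r <= r2.
  move=> /Ale[r0 l1 l2].
  have rS : 0 <= r ^+ 2 + S by rewrite addr_ge0// sqr_ge0.
  have rE : r = Num.sqrt (r ^+ 2) by rewrite sqrtr_sqr gtr0_norm.
  rewrite [X in _ <= X <= _]rE.
  apply/andP; split; apply: ler_wsqrtr.
    rewrite lerBlDr -(sqr_sqrtr rS) lerXn2r ?nnegrE ?sqrtr_ge0// /al'.
      by rewrite le_max lexx orbT.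
    by rewrite ge_max l1 sqrtr_ge0.
  by rewrite lerBrDr -(sqr_sqrtr rS) lerXn2r ?nnegrE ?sqrtr_ge0 ?(ltW be0)//.
have r10 : 0 <= r1 by exact: sqrtr_ge0.
have r20 : 0 < r2.
  by have [u0 _ _] := Ale _ Au; have /andP[_] := Ar12 _ Au;
    exact: lt_le_trans u0.
have r12 : r1 <= r2 by have /andP[h1 h2] := Ar12 _ Au; exact: le_trans h1 h2.
have r2E : r2 ^+ 2 = be ^+ 2 - S.
  by rewrite sqr_sqrtr// ltW// -sqrtr_gt0.
have r1E : al' ^+ 2 - S <= r1 ^+ 2.
  have [h|h] := leP 0 (al' ^+ 2 - S); first by rewrite sqr_sqrtr.
  by rewrite (le_trans (ltW h))// sqr_ge0.
have sq2 : Num.sqrt (r2 ^+ 2 + S) = be.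
  by rewrite r2E subrK sqrtr_sqr gtr0_norm.
have mI : measurable (`[r1, r2]%classic : set (measurableTypeR R)).
  exact: measurable_itv.
apply: (@le_trans _ _ (\int[@lebesgue_measure R]_r
   ((r2 / be)%:E * (\1_(`[r1, r2]%classic : set (measurableTypeR R)) r)%:E))%E).
  apply: ge0_le_integral => //.
  - move=> r _; rewrite lee_fin indicE.
    case: (boolP (r \in A)) => [|_]; last by rewrite mul0r.
    by rewrite inE => -[r0 _]; rewrite mul1r divr_ge0 ?sqrtr_ge0// ltW.
  - exact: measurable_radial_slab.
  - apply: emeasurable_funM => //.
    exact/measurable_EFinP/measurable_indic.
  move=> r _; rewrite -EFinM lee_fin indicE.
  case: (boolP (r \in A)) => [|_]; last first.
    by rewrite mul0r mulr_ge0// divr_ge0// ltW.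
  rewrite inE mul1r => Ar; have /andP[l1 l2] := Ar12 _ Ar.
  rewrite indicE mem_set/= ?in_itv/= ?l1 ?l2// mulr1 -sq2.
  by apply: radial_weight_le => //; case: Ar.
rewrite ge0_integralZl//; last 2 first.
- exact/measurable_EFinP/measurable_indic.
- by rewrite lee_fin divr_ge0// ltW.
rewrite integral_indic//.
rewrite setIT [X in (_ * X)%E]lebesgue_measure_itv/= lte_fin.
case: ifPn => _; last by rewrite mule0 lee_fin.
rewrite -EFinB -EFinM lee_fin mulrAC ler_pdivrMr//.
have -> : 4 * w / `|a| = 2 * (be - al) by rewrite bealE; ring.
have : r2 * (r2 - r1) <= r2 ^+ 2 - r1 ^+ 2 by nra.
have : al' ^+ 2 >= al ^+ 2 \/ al' = 0.
  by rewrite /al' /Num.max; case: ifPn; [right|left].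
have al0 : 0 <= al' by rewrite /al' le_max lexx orbT.
have alal : al <= al' by rewrite /al' le_max lexx.
have albe : al' <= be.
  rewrite /al' ge_max (ltW be0) andbT -subr_ge0 bealE mulr_ge0// divr_ge0//.
have : be ^+ 2 - al' ^+ 2 <= 2 * be * (be - al) by nra.
move: r1E; rewrite r2E; lra.
Qed.

(** * Polar coordinates on the cone over the hyperboloid *)

Section cone.
Variables (R : realType) (n : nat).
Local Notation Rn := (n.-tuple (measurableTypeR R)).
Implicit Types (Y : 'M[R]_n.+1) (s : bool).
Local Open Scope ereal_scope.

Definition sqnorm (z : Rn) : R := (\sum_(i < n) (tnth z i : R) ^+ 2)%R.

Lemma sqnorm_ge0 z : (0 <= sqnorm z)%R.
Proof. by apply: sumr_ge0 => i _; exact: sqr_ge0. Qed.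

Lemma measurable_sqnorm : measurable_fun setT sqnorm.
Proof.
apply: measurable_sum => i; apply: measurable_funX.
exact: measurable_tnth.
Qed.

Definition hyp_slab Y (r : R) : set (hyperboloid R n) :=
  [set q | forall k, (`|\sum_j Y k j * (r * (tnth (hpt q) j : R))| <= 2)%R].

Definition sheet_form Y s k (r : R) (z : Rn) : R :=
  (Y k ord_max * (-1) ^+ s * Num.sqrt (r ^+ 2 + sqnorm z)
   + \sum_j Y k (lift ord_max j) * (tnth z j : R))%R.

(** The region where the forms [Y] are at most [2] in absolute value, in the
    coordinates [(r, z)] of the cone over the sheet [s]: the point
    [r *: sheet s x] of the cone has first components [z = r x] and last
    component [t = (-1) ^+ s * Num.sqrt (r ^+ 2 + sqnorm z)]. *)
Definition polar_slab Y s : set (measurableTypeR R * Rn) :=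
  [set u | (0 < (u.1 : R))%R /\ forall k, (`|sheet_form Y s k u.1 u.2| <= 2)%R].

(** The Lebesgue measure [dz dt] of this region in the coordinates [(r, z)]:
    [dt] is [r / Num.sqrt (r ^+ 2 + sqnorm z)] times [dr]. *)
Definition polar_density Y s (u : measurableTypeR R * Rn) : R :=
  (\1_(polar_slab Y s) u
   * ((u.1 : R) / Num.sqrt ((u.1 : R) ^+ 2 + sqnorm u.2)))%R.

Lemma polar_density_ge0 Y s u : (0 <= polar_density Y s u)%R.
Proof.
rewrite /polar_density indicE; case: (boolP (u \in _)) => [|_];
  last by rewrite mul0r.
by rewrite inE => -[u0 _]; rewrite mul1r divr_ge0 ?sqrtr_ge0// ltW.
Qed.

Lemma measurable_polar_radius :
  measurable_fun setT (fun u : measurableTypeR R * Rn =>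
    Num.sqrt ((u.1 : R) ^+ 2 + sqnorm u.2)%R).
Proof.
apply: measurable_fun_sqrt; apply: measurable_funD.
  by apply: measurable_funX; exact: measurable_fst.
apply: (measurableT_comp measurable_sqnorm); exact: measurable_snd.
Qed.

Lemma measurable_polar_slab Y s : measurable (polar_slab Y s).
Proof.
rewrite (_ : polar_slab Y s =
    (fst @^-1` (`]0%R, +oo[%classic : set (measurableTypeR R))) `&`
    [set u | forall k, (`|sheet_form Y s k u.1 u.2| <= 2)%R]); last first.
  by apply/seteqP; split => u /=; rewrite in_itv/= andbT.
apply: measurableI.
  have mI : measurable (`]0%R, +oo[%classic : set (measurableTypeR R)).
    exact: measurable_itv.
  rewrite -[X in measurable X]setTI.
  exact: (@measurable_fst _ _ (measurableTypeR R) Rn measurableT _ mI).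
apply: measurable_slabs => k; apply: measurable_funD.
  by apply: measurable_funM => //; exact: measurable_polar_radius.
have := @measurable_linear_form R n n (fun j => Y k (lift ord_max j)) id.
move=> h; apply: (measurableT_comp h); exact: measurable_snd.
Qed.

Lemma measurable_polar_density Y s : measurable_fun setT (polar_density Y s).
Proof.
apply: measurable_funM.
  by apply: measurable_indic; exact: measurable_polar_slab.
apply: measurable_funM; first exact: measurable_fst.
apply: measurable_funV_ge0; first by move=> u; exact: sqrtr_ge0.
exact: measurable_polar_radius.
Qed.

Lemma sqrt_scale_height (r : R) (x : Rn) : (0 < r)%R ->
  Num.sqrt (r ^+ 2 + sqnorm (scale_tuple r x))%R = (r * height x)%R.
Proof.
move=> r0; rewrite /sqnorm.
under eq_bigr do rewrite tnth_scale_tuple exprMn.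
rewrite -mulr_sumr -[X in (X + _)%R]mulr1 -mulrDr sqrtrM ?sqr_ge0//.
by rewrite sqrtr_sqr gtr0_norm.
Qed.

Lemma sheet_formE Y s k (r : R) (x : Rn) : (0 < r)%R ->
  sheet_form Y s k r (scale_tuple r x) =
  (\sum_j Y k j * (r * (tnth (hpt (sheet s x)) j : R)))%R.
Proof.
move=> r0; rewrite (bigD1_ord ord_max)//= sheet_pt_max /sheet_form.
rewrite sqrt_scale_height//; congr (_ + _)%R; first by ring.
apply: eq_bigr => j _; rewrite tnth_scale_tuple.
rewrite (_ : lift ord_max j = widen_ord (leqnSn n) j) ?sheet_pt_widen//.
by apply: val_inj; exact: lift_max.
Qed.

(** The substitution [z = r x], which absorbs the factor [r ^+ n]; the density
    of the invariant measure, the inverse of the height of [x], becomes the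
    weight of [polar_density] because [r] times this height is
    [Num.sqrt (r ^+ 2 + sqnorm z)]. *)
Lemma hyp_measure_slab Y (r : R) : (0 < r)%R ->
  (r ^+ n)%:E * hyp_measure R n (hyp_slab Y r) =
  \sum_(s : bool)
    \int[lebesgue_measure_tuple R n]_z (polar_density Y s (r, z))%:E.
Proof.
move=> r0; rewrite /hyp_measure/= /hyp_measure_fun ge0_sume_distrr; last first.
  by move=> s _; apply: integral_ge0 => x _; rewrite lee_fin.
apply: eq_bigr => s _.
have mp : measurable_fun setT (fun z : Rn => (polar_density Y s (r, z))%:E).
  apply/measurable_EFinP.
  exact: (measurableT_comp (measurable_polar_density Y s) (pair1_measurable _)).
rewrite -(ge0_integral_scale_tuple r0 mp); last first.
  by move=> z; rewrite lee_fin polar_density_ge0.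
congr (_ * _); rewrite integral_mkcond; apply: eq_integral => x _.
have h0 : (0 < height x)%R.
  by rewrite sqrtr_gt0 (lt_le_trans _ (height_arg_ge1 x)).
rewrite patchE /polar_density/= sqrt_scale_height// indicE.
have -> : (((r : measurableTypeR R), scale_tuple r x) \in polar_slab Y s) =
    (x \in sheet s @^-1` hyp_slab Y r).
  apply/idP/idP; rewrite !inE.
    by move=> [_ h] k; rewrite -sheet_formE//; exact: h.
  by move=> h; split => //= k; rewrite sheet_formE//; exact: h.
case: ifPn => _; last by rewrite mul0r.
rewrite mul1r sheet_pt_max normrM normr_sign mul1r gtr0_norm//.
by congr (_%:E); field; rewrite !gt_eqF.
Qed.

(** The part of the parallelepiped cut out by [Y] which lies in the cone has at
    most the volume of the parallelepiped. The last coordinate is eliminated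
    first, since it is the one which depends on [r]: for fixed [z] the integral
    over [r] runs over a slab. *)
Lemma polar_integral_le : exists2 C : R, (0 <= C)%R &
  forall Y s, (\det Y != 0)%R ->
  \int[@lebesgue_measure R]_r \int[lebesgue_measure_tuple R n]_z
    (polar_density Y s (r, z))%:E <= (C / `|\det Y|)%:E.
Proof.
have [C C0 HC] := volume_parallelepiped_le R n.
exists (8 * (C * 4 ^+ n))%R; first by rewrite !mulr_ge0// exprn_ge0.
move=> Y s Y0.
have [k [Z [Yk0 dY HZ]]] := pivot_elimination ord_max Y0.
have Z0 : (\det Z != 0)%R.
  by move: Y0; rewrite -normr_eq0 dY mulf_eq0 negb_or !normr_eq0 => /andP[].
pose Q : set Rn := [set x | forall i,
  (`|\sum_j Z i j * (tnth x j : R)| <= 4)%R].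
have mQ : measurable Q.
  by apply: measurable_slabs => i; exact: (measurable_linear_form (Z i) id).
have mp : measurable_fun setT (fun u => (polar_density Y s u)%:E).
  by apply/measurable_EFinP; exact: measurable_polar_density.
have p0 u : 0 <= (polar_density Y s u)%:E by rewrite lee_fin polar_density_ge0.
rewrite (fubini_tonelli _ mp p0).
apply: (@le_trans _ _ (\int[lebesgue_measure_tuple R n]_z
   ((8 / `|Y k ord_max|)%:E * (\1_Q z)%:E))).
  apply: ge0_le_integral => //.
  - by move=> z _; apply: integral_ge0 => r _; exact: p0.
  - exact: (measurable_fun_fubini_tonelli_G
      (fun u => (polar_density Y s u)%:E)).
  - apply: emeasurable_funM => //; exact/measurable_EFinP/measurable_indic.
  move=> z _.
  pose c := (\sum_j Y k (lift ord_max j) * (tnth z j : R))%R.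
  have a0 : (Y k ord_max * (-1) ^+ s != 0)%R by rewrite mulf_neq0// signr_eq0.
  have na : (`|Y k ord_max * (-1) ^+ s| = `|Y k ord_max|)%R.
    by rewrite normrM normr_sign mulr1.
  have -> : (8 / `|Y k ord_max|)%R = (4 * 2 / `|Y k ord_max * (-1) ^+ s|)%R.
    by rewrite na -natrM.
  have := radial_slab c a0 (ler0n _ 2) (sqnorm_ge0 z).
  have := measurable_radial_slab (Y k ord_max * (-1) ^+ s) c 2 (sqnorm z).
  set A := [set r | _] => mA HA.
  have slabQ (r : R) : polar_slab Y s (r, z) -> Q z.
    move=> [_ h] i.
    pose x j := if unlift ord_max j is Some j' then tnth z j' : R
      else ((-1) ^+ s * Num.sqrt (r ^+ 2 + sqnorm z))%R.
    have hx l : (`|\sum_j Y l j * x j| <= 2)%R.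
      rewrite (bigD1_ord ord_max)//= /x unlift_none mulrA.
      by under eq_bigr do rewrite liftK; exact: h.
    have := HZ x 2%R hx i.
    rewrite -natrM /x.
    by under eq_bigr do rewrite liftK.
  have [Qz|nQz] := pselect (Q z); last first.
    rewrite (_ : (fun _ => _) = cst 0)
      ?integral0 ?mule_ge0 ?lee_fin ?divr_ge0//.
    apply/funext => r; rewrite /polar_density indicE memNset ?mul0r//.
    by move=> /slabQ.
  rewrite indicE mem_set// mule1; apply: le_trans HA.
  apply: ge0_le_integral => //.
  - apply/measurable_EFinP.
    exact: (measurableT_comp (measurable_polar_density Y s)
      (pair2_measurable _)).
  - move=> r _; rewrite lee_fin /polar_density/=.
    have [pz|npz] := pselect (polar_slab Y s (r, z)).
      by rewrite !indicE !mem_set//; case: pz => r0 h; split => //; exact: h.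
    rewrite indicE memNset// mul0r indicE.
    case: (boolP (r \in A)) => [|_]; last by rewrite mul0r.
    by rewrite inE => -[r0 _]; rewrite mul1r divr_ge0 ?sqrtr_ge0// ltW.
rewrite ge0_integralZl//; last first.
  exact/measurable_EFinP/measurable_indic.
rewrite integral_indic// setIT.
apply: (le_trans (lee_wpmul2l _ (HC Z 4%R Z0 (ler0n _ 4)))).
  by rewrite lee_fin divr_ge0.
rewrite -EFinM lee_fin dY le_eqVlt; apply/orP; left; apply/eqP.
by field; rewrite !normr_eq0 Yk0 Z0.
Qed.

Lemma measurable_coord j :
  measurable_fun setT (fun q : hyperboloid R n => tnth (hpt q) j : R).
Proof.
move=> _ B mB; rewrite setTI.
exists ((fun t : n.+1.-tuple (measurableTypeR R) => tnth t j) @^-1` B).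
  by have := @measurable_tnth _ (measurableTypeR R) n.+1 j measurableT _ mB;
    rewrite setTI.
by rewrite setTI.
Qed.

Lemma measurable_hyp_slab Y r : measurable (hyp_slab Y r).
Proof.
apply: measurable_slabs => k; apply: measurable_sum => j.
by apply: measurable_funM => //; apply: measurable_funM => //;
  exact: measurable_coord.
Qed.

(** The lower bound [g u.1 / 2] on the radius keeps [r ^+ n] comparable to the
    [n]th power of [g u.1], so that its integral over the interval of radii is
    comparable to the next power. *)
Definition dyadic_shell (g : hyperboloid R n -> R) :
    set (hyperboloid R n * measurableTypeR R) :=
  [set u | (0 < u.2 :> R)%R /\ (g u.1 / 2 <= u.2 <= g u.1)%R].

Lemma measurable_dyadic_shell g : measurable_fun setT g ->
  measurable (dyadic_shell g).
Proof.
move=> mg.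
pose H := hyperboloid R n.
have m1 : measurable_fun setT (fun u : H * measurableTypeR R => g u.1).
  by apply: (measurableT_comp mg); exact: measurable_fst.
have m2 : measurable_fun setT (fun u : H * measurableTypeR R => u.2 : R).
  exact: measurable_snd.
have mP (f : H * measurableTypeR R -> R) : measurable_fun setT f ->
    measurable [set u | (0 <= f u)%R].
  move=> mf.
  have mI : measurable (`[0%R, +oo[%classic : set (measurableTypeR R)).
    exact: measurable_itv.
  rewrite (_ : [set _ | _] = f @^-1` `[0%R, +oo[%classic); last first.
    by apply/seteqP; split => u /=; rewrite in_itv/= andbT.
  by rewrite -[X in measurable X]setTI; exact: mf.
rewrite (_ : dyadic_shell g =
    (snd @^-1` (`]0%R, +oo[%classic : set (measurableTypeR R))) `&`
    ([set u | (0 <= u.2 - g u.1 / 2)%R] `&` [set u | (0 <= g u.1 - u.2)%R])).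
  apply: measurableI.
    have mI : measurable (`]0%R, +oo[%classic : set (measurableTypeR R)).
      exact: measurable_itv.
    by rewrite -[X in measurable X]setTI; exact: m2.
  apply: measurableI; apply: mP; apply: measurable_funB => //.
  exact: measurable_funM.
apply/seteqP; split => u /=; rewrite in_itv/= andbT !subr_ge0.
  by move=> [? /andP[]].
by move=> [? [? ?]]; split => //; apply/andP.
Qed.

(** Up to a constant, the integral of [g ^+ n.+1] is the volume of the part of
    the cone between [0] and the points [g q] times [q]. If these points lie in
    the parallelepiped cut out by [Y], so does this part of the cone, because
    the parallelepiped is star-shaped. Exchanging the integrals over [q] and [r]
    leaves only measures of sets of points of the hyperboloid, on which
    [hyp_measure_slab] applies. *)
Lemma ge0_integral_cone_le : exists2 C : R, (0 <= C)%R &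
  forall Y (g : hyperboloid R n -> R) (N : set (hyperboloid R n)),
  (\det Y != 0)%R -> measurable_fun setT g -> (forall q, 0 <= g q)%R ->
  (hyp_measure R n).-negligible N ->
  (forall q, ~ N q -> forall k,
    (`|\sum_j Y k j * (g q * (tnth (hpt q) j : R))| <= 2)%R) ->
  \int[hyp_measure R n]_q ((g q) ^+ n.+1)%:E <= (C / `|\det Y|)%:E.
Proof.
have [C C0 HC] := polar_integral_le.
exists (2 ^+ n.+1 * (2 * C))%R; first by rewrite !mulr_ge0// exprn_ge0.
move=> Y g N Y0 mg g0 [N' [mN' N'0 NN']] HN.
pose G := dyadic_shell g.
have mG : measurable G by exact: measurable_dyadic_shell.
pose E (u : hyperboloid R n * measurableTypeR R) : \bar R :=
  (\1_G u * (u.2 : R) ^+ n)%:E.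
have mE : measurable_fun setT E.
  apply/measurable_EFinP; apply: measurable_funM; first exact: measurable_indic.
  by apply: measurable_funX; exact: measurable_snd.
have E0 u : 0 <= E u.
  rewrite lee_fin indicE; case: (boolP (u \in G)) => [|_];
    last by rewrite mul0r.
  by rewrite inE => -[u0 _]; rewrite mul1r exprn_ge0// ltW.
apply: (@le_trans _ _ ((2 ^+ n.+1)%:E *
    \int[hyp_measure R n]_q \int[@lebesgue_measure R]_r E (q, r))).
  rewrite -ge0_integralZl//; last 2 first.
  - exact: (measurable_fun_fubini_tonelli_F E).
  - by move=> q _; exact: integral_ge0.
  apply: ge0_le_integral => //.
  - by move=> q _; rewrite lee_fin exprn_ge0.
  - by apply/measurable_EFinP; exact: measurable_funX.
  - apply: emeasurable_funM => //; exact: (measurable_fun_fubini_tonelli_F E).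
  move=> q _.
  have [gq|gq] := eqVneq (g q) 0%R.
    by rewrite gq expr0n mule_ge0 ?lee_fin ?exprn_ge0//; exact: integral_ge0.
  have {}gq : (0 < g q)%R by rewrite lt_neqAle eq_sym gq g0.
  pose J : set (measurableTypeR R) := `[(g q / 2)%R, (g q)]%classic.
  have mI : measurable J.
    exact: measurable_itv.
  (* The interval of radii has length [g q / 2], and on it [r] is at least
     [g q / 2]. *)
  apply: (@le_trans _ _ ((2 ^+ n.+1)%:E * (\int[@lebesgue_measure R]_r
     (((g q / 2) ^+ n)%:E * (\1_J r)%:E)))).
    rewrite ge0_integralZl//; last 2 first.
    - exact/measurable_EFinP/measurable_indic.
    - by rewrite lee_fin exprn_ge0// divr_ge0// ltW.
    rewrite integral_indic// setIT [X in _ * (_ * X)]lebesgue_measure_itv/=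
      lte_fin.
    rewrite ifT; last by rewrite ltr_pdivrMr// ltr_pMr// ltr1n.
    rewrite -EFinB -!EFinM lee_fin.
    rewrite (_ : (g q - g q / 2 = g q / 2)%R); last by field.
    by rewrite -exprSr -exprMn mulrC divfK.
  rewrite lee_wpmul2l ?lee_fin ?exprn_ge0//.
  apply: ge0_le_integral => //.
  - by move=> r _; rewrite mule_ge0// lee_fin// exprn_ge0// divr_ge0// ltW.
  - apply: emeasurable_funM => //; exact/measurable_EFinP/measurable_indic.
  - exact: (measurableT_comp mE (pair1_measurable _)).
  move=> r _; rewrite -EFinM lee_fin indicE.
  case: (boolP (r \in _)) => [|_]; last first.
    by rewrite mulr0; have := E0 (q, r); rewrite lee_fin.
  rewrite inE /J/= in_itv/= mulr1 => /andP[r1 r2].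
  have g2 : (0 < g q / 2)%R by rewrite divr_gt0.
  rewrite indicE mem_set ?mul1r.
    by rewrite lerXn2r// nnegrE ltW// (lt_le_trans g2).
  by split => /=; [exact: lt_le_trans r1|rewrite r1 r2].
rewrite (fubini_tonelli E)//.
rewrite -mulrA EFinM lee_wpmul2l ?lee_fin ?exprn_ge0//.
apply: (@le_trans _ _ (\int[@lebesgue_measure R]_r \sum_(s : bool)
    \int[lebesgue_measure_tuple R n]_z (polar_density Y s (r, z))%:E)).
  apply: ge0_le_integral => //.
  - by move=> r _; exact: integral_ge0.
  - exact: (measurable_fun_fubini_tonelli_G E).
  - apply: emeasurable_sum => s.
    apply: (measurable_fun_fubini_tonelli_F (fun u =>
      (polar_density Y s u)%:E)).
      by apply/measurable_EFinP; exact: measurable_polar_density.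
    by move=> u; rewrite lee_fin polar_density_ge0.
  move=> r _.
  have [r0|r0] := leP r 0%R.
    rewrite (_ : (fun _ => _) = cst 0) ?integral0.
      apply: sume_ge0 => s _; apply: integral_ge0 => z _.
      by rewrite lee_fin polar_density_ge0.
    apply/funext => q; rewrite /E indicE memNset ?mul0r// => -[] /=.
    by rewrite ltNge r0.
  rewrite -hyp_measure_slab//.
  have mGr : measurable [set q | G (q, r)].
    have := @pair2_measurable _ _ (hyperboloid R n) (measurableTypeR R)
      r measurableT _ mG.
    by rewrite setTI.
  rewrite (_ : (fun q => E (q, r)) =
      (fun q => (r ^+ n)%:E * (\1_[set q | G (q, r)] q)%:E)); last first.
    by apply/funext => q; rewrite /E muleC -EFinM.
  rewrite ge0_integralZl//; last 2 first.
  - exact/measurable_EFinP/measurable_indic.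
  - by rewrite lee_fin exprn_ge0// ltW.
  rewrite integral_indic// setIT lee_wpmul2l ?lee_fin ?exprn_ge0 ?(ltW r0)//.
  rewrite -(measureU0 (measurable_hyp_slab Y r) mN' N'0).
  apply: (@le_measure _ _ _ (hyp_measure R n)); rewrite ?inE//.
    by apply: measurableU => //; exact: measurable_hyp_slab.
  move=> q [/= _ /andP[_ rg]].
  have [N'q|N'q] := pselect (N' q); [by right|left] => k.
  have gq : (0 < g q)%R by exact: lt_le_trans rg.
  have -> : (\sum_j Y k j * (r * (tnth (hpt q) j : R)) =
      r / g q * \sum_j Y k j * (g q * (tnth (hpt q) j : R)))%R.
    rewrite mulr_sumr; apply: eq_bigr => j _; field.
    by rewrite gt_eqF.
  rewrite normrM ger0_norm ?divr_ge0 ?(ltW r0)// -[leRHS]mul1r.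
  rewrite ler_pM// ?divr_ge0 ?(ltW r0)//; first by rewrite ler_pdivrMr ?mul1r.
  by apply: HN => Nq; apply: N'q; exact: NN'.
rewrite ge0_integral_sum//; last 2 first.
- move=> s.
  apply: (measurable_fun_fubini_tonelli_F (fun u => (polar_density Y s u)%:E)).
    by apply/measurable_EFinP; exact: measurable_polar_density.
  by move=> u; rewrite lee_fin polar_density_ge0.
- move=> s r _; apply: integral_ge0 => z _.
  by rewrite lee_fin polar_density_ge0.
apply: (le_trans (lee_sum _ (fun s _ => HC Y s Y0))).
by rewrite sumEFin sumr_const card_bool lee_fin -[leRHS]mulrA mulr_natl.
Qed.
End cone.

(** * Essential bounds and pointwise bounds *)

(** Almost every point is essential for finitely many measurable functions: the
    values near those it takes are taken on a set of positive measure. The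
    exceptional points are covered by the countably many boxes with rational
    centres and radii whose preimage is negligible. *)
Lemma essential_points d (T : measurableType d) (R : realType)
    (mu : {measure set T -> \bar R}) (I : finType) (phi : I -> T -> R) :
  (forall i, measurable_fun setT (phi i)) ->
  exists2 N, mu.-negligible N & forall q, ~ N q -> forall e, 0 < e ->
    (0 < mu [set q' | forall i, (`|phi i q' - phi i q| <= e)%R])%E.
Proof.
move=> mphi.
pose box (c : I -> R) (e : R) : set T :=
  [set q | forall i, `|phi i q - c i| <= e].
have mbox c e : measurable (box c e).
  by apply: measurable_slabs => i; exact: measurable_funB.
pose rbox (u : {ffun I -> rat} * nat) :=
  box (fun i => ratr (u.1 i)) u.2.+1%:R^-1.
pose F k := if unpickle k is Some u then
  (if mu (rbox u) == 0%E then rbox u else set0) else set0.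
exists (\bigcup_k F k).
  apply: negligible_bigcup => k; rewrite /F.
  case: unpickle => [u|]; last exact: negligible_set0.
  case: ifPn => [/eqP u0|_]; last exact: negligible_set0.
  by exists (rbox u); split => //; exact: mbox.
move=> q Nq e e0.
pose k := Num.bound (2 / e).
have k0 : 0 < k.+1%:R^-1 :> R by rewrite invr_gt0.
have ke : 2 * k.+1%:R^-1 <= e.
  rewrite ler_pdivrMr// mulrC -ler_pdivrMr// ltW//.
  rewrite (lt_le_trans (archi_boundP _)) ?ler_nat//.
  by rewrite divr_ge0// ltW.
have H (i : I) : exists r : rat, `|phi i q - ratr r| <= k.+1%:R^-1.
  have lt : phi i q - k.+1%:R^-1 < phi i q + k.+1%:R^-1 by rewrite ltrD2l gtrN.
  have [r] := rat_in_itvoo lt; rewrite in_itv/= => /andP[r1 r2].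
  by exists r; rewrite distrC ler_distl (ltW r1) (ltW r2).
have [c Hc] := choice H.
pose u : {ffun I -> rat} * nat := ([ffun i => c i], k).
have qu : rbox u q by move=> i; rewrite ffunE; exact: Hc.
have u0 : (0 < mu (rbox u))%E.
  rewrite lt0e measure_ge0 andbT; apply/eqP => u0.
  by apply: Nq; exists (pickle u) => //; rewrite /F pickleK u0 eqxx.
apply: (lt_le_trans u0); apply: le_measure; rewrite ?inE;
  [exact: mbox|exact: (mbox (phi ^~ q) e)|].
move=> q' h i; have := h i; have := qu i.
have -> : phi i q' - phi i q =
    (phi i q' - ratr (u.1 i)) - (phi i q - ratr (u.1 i)) by ring.
move=> h1 h2; rewrite (le_trans (ler_normB _ _))//.
by apply: le_trans ke; rewrite mulr2n mulrDl mul1r lerD.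
Qed.

Lemma continuous_det (R : realType) (D : nat) :
  continuous (fun X : 'M[R]_D => \det X).
Proof.
rewrite /determinant; apply: continuous_big => [|s _].
  exact: (@add_continuous R^o).
have cP : continuous (fun X : 'M[R]_D => \prod_i X i (s i)).
  apply: continuous_big => [|i _]; last exact: coord_continuous.
  exact: (@mul_continuous R).
move=> X; apply: (@continuous_comp _ R R (fun X : 'M[R]_D => \prod_i X i (s i))
  ( *%R ((-1) ^+ s))); [exact: cP|exact: mulrl_continuous].
Qed.

Lemma det_gt_near (R : realType) (D : nat) (X : 'M[R]_D) (m : R) :
  m < `|\det X| -> exists2 e : R, 0 < e &
  forall X' : 'M[R]_D, (forall i j, `|X' i j - X i j| <= e) -> m < `|\det X'|.
Proof.
move=> mX.
have : \forall Z \near X, m < `|\det Z|.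
  have c : (fun Z : 'M[R]_D => `|\det Z|) @ X --> `|\det X|.
    apply: (@continuous_comp _ R R
      (fun Z : 'M[R]_D => \det Z) (fun u : R => `|u|)).
      exact: (@continuous_det R D X).
    exact: norm_continuous.
  by apply: (cvgr_gt _ c).
move=> /nbhs_ballP[e /= e0 He].
exists (e / 2); first by rewrite divr_gt0.
move=> X' HX'; apply: He; split => // i j; rewrite /ball/=.
rewrite distrC (le_lt_trans (HX' i j))//.
by rewrite ltr_pdivrMr// ltr_pMr// ltr1n.
Qed.

(** An essential upper bound for the determinant holds at all tuples of
    essential points: by continuity a violation would persist on a product of
    sets of positive measure, whose product measure is positive. *)
Lemma ae_det_le_pointwise d (T : measurableType d) (R : realType)
    (mu : {sigma_finite_measure set T -> \bar R}) (D : nat)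
    (x : 'I_D -> 'I_D -> T -> R) (m : R) :
  (forall j i, measurable_fun setT (x j i)) ->
  {ae tuple_measure mu D, forall t,
    `|\det (\matrix_(i, j) x j i (tnth t j))| <= m} ->
  exists2 N : 'I_D -> set T, (forall j, mu.-negligible (N j)) &
  forall q, (forall j, ~ N j (q j)) ->
    `|\det (\matrix_(i, j) x j i (q j))| <= m.
Proof.
move=> mx [Z [mZ Z0 HZ]].
have H j := essential_points mu (mx j).
pose N j := sval (cid2 (H j)).
exists N; first by move=> j; rewrite /N; case: cid2.
move=> q Nq; rewrite leNgt; apply/negP => /det_gt_near[e e0 He].
pose A j : set T := [set q' | forall i, `|x j i q' - x j i (q j)| <= e].
have mA j : measurable (A j).
  by apply: measurable_slabs => i; exact: measurable_funB.
have A0 j : (0 < mu (A j))%E.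
  by move: (Nq j); rewrite /N; case: cid2 => N' _ /= /(_ (q j)) h /h; exact.
have : (0 < tuple_measure mu D [set t | forall j, A j (tnth t j)])%E.
  rewrite tuple_measure_box//; elim/big_ind : _ => //.
  by move=> a b; exact: mule_gt0.
apply/negP; rewrite -leNgt -Z0.
apply: le_measure; rewrite ?inE//.
  rewrite (_ : [set t | _] =
      \bigcap_(j in [set: 'I_D]) ((@tnth _ T ^~ j) @^-1` A j)).
    apply: fin_bigcap_measurable => // j _.
    by have := @measurable_tnth _ T D j measurableT _ (mA j); rewrite setTI.
  by apply/seteqP; split=> t /= h j; [move=> _; exact: h|exact: h].
move=> t At; apply: HZ => /=; apply/negP; rewrite -ltNge; apply: He => i j.
by rewrite !mxE; exact: At.
Qed.

(** * Integrals and nearly maximal frames *)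

Section frame.
Variables (R : realType) (n : nat).
Local Notation H := (hyperboloid R n).

Definition scaled_points (g : H -> R) (N : set H) : set 'cV[R]_n.+1 :=
  [set x | exists2 q, ~ N q & x = \col_i (g q * (tnth (hpt q) i : R))].

Lemma ge0_integral_le_frame : exists2 C : R, 0 <= C &
  forall (g : H -> R) (N : set H) (X : 'M[R]_n.+1),
  measurable_fun setT g -> (forall q, 0 <= g q) ->
  (hyp_measure R n).-negligible N -> \det X != 0 ->
  (forall x, scaled_points g N x -> forall k, `|(invmx X *m x) k 0| <= 2) ->
  (\int[hyp_measure R n]_q ((g q) ^+ n.+1)%:E <= (C * `|\det X|)%:E)%E.
Proof.
have [C C0 HC] := ge0_integral_cone_le R n.
exists C => // g N X mg g0 nN X0 HX.
rewrite -[`|\det X|]invrK -normfV -det_inv; apply: (HC _ _ N) => //.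
  by rewrite det_inv invr_eq0.
move=> q Nq k.
have := HX _ (ex_intro2 _ _ q Nq erefl) k; rewrite mxE.
by under eq_bigr do rewrite mxE.
Qed.

(** If the points [g q] times [q] span a proper subspace, they fill no volume.
    To see it without choosing a subspace, truncate them to a ball of radius
    [i.+1] and add the small multiples [e *: delta_mx k 0] of the basis vectors.
    The enlarged set has nonzero determinants, all of which involve a small
    vector and thus are of order [e]; a nearly maximal frame shows that the
    integral is of order [e] too. *)
Lemma ge0_integral_degenerate (g : H -> R) (N : set H) :
  measurable_fun setT g -> (forall q, 0 <= g q) ->
  (hyp_measure R n).-negligible N ->
  (forall X : 'M[R]_n.+1,
    (forall j, scaled_points g N (col j X)) -> \det X = 0) ->
  (\int[hyp_measure R n]_q ((g q) ^+ n.+1)%:E = 0)%E.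
Proof.
move=> mg g0 nN HX.
have [C C0 HC] := ge0_integral_le_frame.
pose small (i : nat) : set H :=
  [set q | forall l, `|g q * (tnth (hpt q) l : R)| <= i.+1%:R].
have msmall i : measurable (small i).
  by apply: measurable_slabs => l; apply: measurable_funM => //;
    exact: measurable_coord.
pose h i q := g q * \1_(small i) q.
have mh i : measurable_fun setT (h i).
  by apply: measurable_funM => //; exact: measurable_indic.
have h0 i q : 0 <= h i q by rewrite mulr_ge0.
have mhD i : measurable_fun setT (fun q => (h i q ^+ n.+1)%:E).
  by apply/measurable_EFinP; exact: measurable_funX.
have step i (e : R) : 0 < e -> e <= 1 ->
    (\int[hyp_measure R n]_q ((h i q) ^+ n.+1)%:E
     <= (C * (n.+1`!%:R * (e * i.+1%:R ^+ n)))%:E)%E.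
  move=> e0 e1.
  pose K : set 'cV[R]_n.+1 :=
    [set x | (scaled_points g N x /\ forall l, `|x l 0| <= i.+1%:R) \/
             exists k, x = e *: delta_mx k 0].
  have Ki x : K x -> forall l, `|x l 0| <= i.+1%:R.
    move=> [[]//|[k ->] l]; rewrite !mxE eqxx andbT.
    rewrite (@le_trans _ _ 1) ?ler1n// normrM (gtr0_norm e0)
      mulr_ile1// ?(ltW e0)//.
    by case: (l == k); rewrite ?normr1 ?normr0.
  have KB (X : 'M[R]_n.+1) : (forall j, K (col j X)) ->
      `|\det X| <= n.+1`!%:R * (e * i.+1%:R ^+ n).
    move=> KX.
    have Xi l j : `|X l j| <= i.+1%:R by have := Ki _ (KX j) l; rewrite mxE.
    have [[j [k jk]]|nj] :=
        pselect (exists j k, col j X = e *: delta_mx k 0); last first.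
      rewrite HX ?normr0 ?mulr_ge0 ?exprn_ge0 ?(ltW e0)// => j.
      by have [[]//|[k jk]] := KX j; exfalso; apply: nj; exists j, k.
    rewrite -det_tr.
    have -> : e * i.+1%:R ^+ n =
        \prod_(l < n.+1) (if l == j then e else i.+1%:R).
      rewrite (bigD1_ord j)//= eqxx; congr (_ * _).
      under eq_bigr do rewrite eq_sym (negbTE (neq_lift _ _)).
      by rewrite prodr_const card_ord.
    apply: norm_det_le => l m; rewrite mxE; case: eqP => [->|_]; last exact: Xi.
    have -> : X m j = col j X m 0 by rewrite mxE.
    rewrite jk !mxE eqxx andbT normrM (gtr0_norm e0) ler_piMr ?(ltW e0)//.
    by case: (m == k); rewrite ?normr1 ?normr0.
  have [|X [KX X0 XK]] := near_max_frame KB.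
    exists (e%:M); last by rewrite det_scalar expf_neq0// gt_eqF.
    move=> j; right; exists j; apply/colP => l; rewrite !mxE eqxx andbT.
    by rewrite mulr_natr.
  apply: (@le_trans _ _ (C * `|\det X|)%:E); last first.
    by rewrite lee_fin ler_wpM2l// KB.
  apply: (HC _ N) => // x [q Nq ->] k.
  have [qs|qs] := pselect (small i q).
    apply: XK; left; rewrite /h indicE mem_set// mulr1; split;
      first by exists q.
    by move=> l; rewrite mxE; exact: qs.
  rewrite mxE big1 ?normr0// => l _.
  by rewrite mxE /h indicE memNset// mulr0 mul0r mulr0.
have hi0 i : (\int[hyp_measure R n]_q ((h i q) ^+ n.+1)%:E = 0)%E.
  apply/eqP; rewrite eq_le; apply/andP; split; last first.
    by apply: integral_ge0 => q _; rewrite lee_fin exprn_ge0.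
  pose B := C * (n.+1`!%:R * i.+1%:R ^+ n).
  have B0 : 0 <= B by rewrite !mulr_ge0 ?exprn_ge0.
  apply/lee_addgt0Pr => e e0; rewrite add0e.
  pose d := Num.min 1 (e / (B + 1)).
  have B1 : 0 < B + 1 by lra.
  have d0 : 0 < d by rewrite lt_min ltr01 divr_gt0.
  apply: (le_trans (step i d d0 _)); first by rewrite ge_min lexx.
  rewrite lee_fin.
  have -> : C * (n.+1`!%:R * (d * i.+1%:R ^+ n)) = d * B by rewrite /B; ring.
  apply: (@le_trans _ _ (e / (B + 1) * B)).
    by rewrite ler_wpM2r// ge_min lexx orbT.
  by rewrite mulrAC ler_pdivrMr// ler_pM2l// lerDl.
have ae0 : \forall q \ae (hyp_measure R n), forall i, h i q ^+ n.+1 = 0.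
  apply/ae_foralln => i.
  have : (\int[hyp_measure R n]_q `|((h i q) ^+ n.+1)%:E| = 0)%E.
    rewrite -[RHS](hi0 i); apply: eq_integral => q _.
    by rewrite gee0_abs// lee_fin exprn_ge0.
  move=> /(ae_eq_integral_abs _ measurableT (mhD i)).
  by apply: filterS => q /(_ Logic.I) [].
rewrite (ae_eq_integral (cst 0%E))//.
- by rewrite integral_cst// mul0e.
- by apply/measurable_EFinP; exact: measurable_funX.
- apply: filterS ae0 => q hq _ /=.
  pose i := (\max_(l < n.+1) Num.bound (`|g q * (tnth (hpt q) l : R)|)%R)%N.
  have qi : small i q.
    move=> l; apply: ltW; apply: lt_le_trans (archi_boundP _) _ => //.
    rewrite ler_nat leqW// /i.
    exact: (leq_bigmax (F := fun l : 'I_n.+1 =>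
      Num.bound (`|g q * (tnth (hpt q) l : R)|)%R) l).
  by have := hq i; rewrite /h indicE mem_set// mulr1 => ->.
Qed.

End frame.

(** * The inequality for several functions *)

(** It ensures that an essential supremum of nonnegative functions is
    nonnegative, also after taking powers of the measure. *)
Lemma hyp_measureT_gt0 (R : realType) (n : nat) :
  (0 < hyp_measure R n setT)%E.
Proof.
rewrite lt0e measure_ge0 andbT; apply/eqP => nu0.
pose w (x : n.-tuple (measurableTypeR R)) : \bar R := ((height x)^-1)%:E.
have h0 (x : n.-tuple (measurableTypeR R)) : 0 < height x.
  by rewrite sqrtr_gt0 (lt_le_trans _ (height_arg_ge1 x)).
have mw : measurable_fun setT w.
  apply/measurable_EFinP; apply: measurable_funV_ge0; first by move=> ?;
    exact: ltW.
  exact: measurable_height.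
have w0 : (\int[lebesgue_measure_tuple R n]_x `|w x| = 0)%E.
  have : (\sum_(s : bool) \int[lebesgue_measure_tuple R n]_(x in setT)
      (`|tnth (sheet s x) ord_max|^-1)%:E = 0)%E by exact: nu0.
  rewrite big_bool/= => /eqP; rewrite padde_eq0; last 2 first.
  - by apply: integral_ge0 => x _; rewrite lee_fin invr_ge0.
  - by apply: integral_ge0 => x _; rewrite lee_fin invr_ge0.
  move=> /andP[/eqP e _]; rewrite -[RHS]e; apply: eq_integral => x _.
  by rewrite sheet_pt_max normrM normr_sign mul1r normfV gtr0_norm.
have /(ae_eq_integral_abs _ measurableT mw) := w0.
move=> [N [mN N0 HN]].
have NT : N = [set t | forall i : 'I_n, [set: measurableTypeR R] (tnth t i)].
  apply/seteqP; split => // x _; apply: HN => /= /(_ Logic.I) [].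
  by apply/eqP; rewrite gt_eqF// invr_gt0.
have := @tuple_measure_box _ (measurableTypeR R) R
  [the {sigma_finite_measure set _ -> \bar R} of @lebesgue_measure R] n
  (fun=> setT) (fun=> measurableT).
rewrite -NT; move: N0; rewrite /lebesgue_measure_tuple => -> /esym/eqP.
apply/negP; rewrite gt_eqF//; elim/big_ind : _ => //.
  by move=> a b; exact: mule_gt0.
move=> i _; have := @lebesgue_measure_itv R `]-oo, +oo[.
rewrite set_itvNyy/= => ->; exact: lt0y.
Qed.

(** Each integral is at most a constant times the determinant of a nearly
    maximal frame of points of its own set, and choosing one vector in each
    frame produces a determinant which is at most [m]. The same transversal
    inequality, with the other frames fixed, shows that the determinants of
    frames are bounded. When a set contains no frame its integral vanishes,
    which is the first alternative. *)
Lemma integral_frames_le (R : realType) (n : nat) : exists2 C : R, 0 < C &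
  forall (g : 'I_n.+1 -> hyperboloid R n -> R)
    (N : 'I_n.+1 -> set (hyperboloid R n)) (m : R),
  (forall j, measurable_fun setT (g j)) -> (forall j q, 0 <= g j q) ->
  (forall j, (hyp_measure R n).-negligible (N j)) -> 0 <= m ->
  (forall q, (forall j, ~ N j (q j)) ->
    `|\det (\matrix_(i, j) (g j (q j) * (tnth (hpt (q j)) i : R)))| <= m) ->
  (exists j, \int[hyp_measure R n]_q ((g j q) ^+ n.+1)%:E = 0)%E \/
  (exists a : 'I_n.+1 -> R, [/\ forall j, 0 <= a j,
    (forall j, \int[hyp_measure R n]_q ((g j q) ^+ n.+1)%:E <= (a j)%:E)%E &
    \prod_j a j <= C * m ^+ n.+1]).
Proof.
have [C C0 HC] := ge0_integral_le_frame R n.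
have [T T1 HT] := transversal_det R n.+1.
exists ((C + 1) ^+ n.+1 * T).
  by rewrite mulr_gt0 ?exprn_gt0 ?(lt_le_trans _ T1)//; lra.
move=> g N m mg g0 nN m0 Hm.
pose K j := scaled_points (g j) (N j).
have KT (X : 'I_n.+1 -> 'M[R]_n.+1) : (forall j k, K j (col k (X j))) ->
    \prod_j `|\det (X j)| <= T * m ^+ n.+1.
  move=> KX; have [c Hc] := HT X; apply: (le_trans Hc).
  rewrite ler_wpM2l ?(le_trans _ T1)// lerXn2r ?nnegrE//.
  have H j : exists q, ~ N j q /\ forall i,
    X j i (c j) = g j q * (tnth (hpt q) i : R).
    have [q Nq /colP e] := KX j (c j); exists q; split => // i.
    by have := e i; rewrite !mxE.
  have [q Hq] := choice H.
  have := Hm q (fun j => (Hq j).1); congr (`| \det _ | <= _).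
  by apply/matrixP => i j; rewrite !mxE (Hq j).2.
have [[j Hj]|nd] := pselect (exists j, forall X : 'M[R]_n.+1,
    (forall k, K j (col k X)) -> \det X = 0).
  by left; exists j; exact: (ge0_integral_degenerate (mg j) (g0 j) (nN j)).
have H0 j : exists X : 'M[R]_n.+1, (forall k, K j (col k X)) /\ \det X != 0.
  apply: contrapT => h; apply: nd; exists j => X KX.
  by apply/eqP/negPn/negP => dX; apply: h; exists X.
have [X0 HX0] := choice H0.
right.
have H j : exists X : 'M[R]_n.+1, (forall k, K j (col k X)) /\
    (\int[hyp_measure R n]_q ((g j q) ^+ n.+1)%:E <= (C * `|\det X|)%:E)%E.
  pose P := \prod_(i < n) `|\det (X0 (lift j i))|.
  have P0 : 0 < P by apply: prodr_gt0 => i _; rewrite normr_gt0 (HX0 _).2.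
  have [X KX||X [KX dX XK]] := @near_max_frame R n.+1 (K j) (T * m ^+ n.+1 / P).
  - rewrite ler_pdivlMr//.
    have := KT (fun i => if i == j then X else X0 i).
    rewrite (bigD1_ord j)//= eqxx.
    under eq_bigr do rewrite eq_sym (negbTE (neq_lift _ _)).
    apply => i k; case: eqP => [->|_]; first exact: KX.
    exact: (HX0 i).1.
  - by exists (X0 j); have [] := HX0 j.
  by exists X; split => //; exact: (HC _ (N j)).
have [X HX] := choice H.
exists (fun j => (C + 1) * `|\det (X j)|); split.
- by move=> j; rewrite mulr_ge0//; lra.
- move=> j; apply: (le_trans (HX j).2); rewrite lee_fin ler_wpM2r//; lra.
rewrite big_split/= prodr_const card_ord -mulrA ler_wpM2l ?exprn_ge0//;
  first lra.
by apply: KT => j; exact: (HX j).1.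
Qed.

(** * Return to the functional of the theorem *)

Lemma powR_prod (R : realType) (I : finType) (a : I -> R) (k : R) :
  (forall i, 0 <= a i) -> (\prod_i a i) `^ k = \prod_i (a i `^ k).
Proof.
move=> a0.
suff [] : 0 <= \prod_i a i /\ (\prod_i a i) `^ k = \prod_i (a i `^ k) by [].
elim/big_rec2 : _ => [|i y x _ [x0 xy]]; first by rewrite powR1.
by rewrite mulr_ge0// powRM// xy.
Qed.

Lemma det_scale_cols (R : comNzRingType) (D : nat) (A : 'M[R]_D)
  (c : 'I_D -> R) :
  \det (\matrix_(i, j) (c j * A i j)) = (\prod_j c j) * \det A.
Proof.
rewrite (_ : \matrix_(_, _) _ = A *m diag_mx (\row_j c j)); last first.
  apply/matrixP => i j; rewrite !mxE (bigD1 j)//= big1 ?addr0; last first.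
    by move=> l lj; rewrite !mxE (negbTE lj) mulr0n mulr0.
  by rewrite !mxE eqxx mulr1n mulrC.
rewrite det_mulmx det_diag mulrC; congr (_ * _).
by apply: eq_bigr => j _; rewrite mxE.
Qed.

(** The exponent [p / n.+1%:R] makes the functional a determinant: the weights
    are absorbed into its columns. *)
Lemma prod_det_powR (R : realType) (n : nat) (p : R)
    (F : 'I_n.+1 -> hyperboloid R n -> R) (q : n.+1.-tuple (hyperboloid R n)) :
  0 < p -> (forall j x, 0 <= F j x) ->
  `|\det (\matrix_(i, j) (F j (tnth q j) `^ (p / n.+1%:R)
                         * (tnth (hpt (tnth q j)) i : R)))|
  = ((\prod_j F j (tnth q j)) * hyp_det q `^ (n.+1%:R / p)) `^ (p / n.+1%:R).
Proof.
move=> p0 F0.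
have := det_scale_cols (\matrix_(i, j) (tnth (hpt (tnth q j)) i : R))
  (fun j => F j (tnth q j) `^ (p / n.+1%:R)).
rewrite (_ : \matrix_(_, _) _ = \matrix_(i, j) (F j (tnth q j) `^ (p / n.+1%:R)
    * (tnth (hpt (tnth q j)) i : R))) => [->|]; last first.
  by apply/matrixP => i j; rewrite !mxE.
rewrite normrM -/(hyp_det q) powRM ?powR_ge0 ?prodr_ge0// powR_prod//.
rewrite -powRrM (_ : n.+1%:R / p * (p / n.+1%:R) = 1); last first.
  by rewrite mulrA divfK ?gt_eqF// divff// pnatr_eq0.
rewrite powRr1 ?normr_ge0//; congr (_ * _).
by rewrite ger0_norm// prodr_ge0// => j _; exact: powR_ge0.
Qed.

Lemma lee_prod (R : realType) (I : finType) (f g : I -> \bar R) :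
  (forall i, 0 <= f i)%E -> (forall i, f i <= g i)%E ->
  (\big[*%E/1]_i f i <= \big[*%E/1]_i g i)%E.
Proof.
move=> f0 fg.
suff [] : (0 <= \big[*%E/1]_i f i /\ \big[*%E/1]_i f i <= \big[*%E/1]_i g i)%E
  by [].
elim/big_rec2 : _ => [|i y x _ [x0 xy]]; first by rewrite lexx lee01.
by rewrite mule_ge0//; split => //; exact: lee_pmul.
Qed.

Theorem theorem4p11 (R : realType) (n : nat) (p : R)
    (hn : (1 <= n)%N) (hp : 0 < p) :
  exists E : R, forall F : 'I_n.+1 -> hyperboloid R n -> R,
    (forall j, F j \in Lfun (hyp_measure R n) p%:E) ->
    (forall j q, 0 <= F j q) ->
    (\big[*%E/1]_(j < n.+1) 'N[hyp_measure R n]_p%:E [EFin \o F j]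
     <= E%:E * ess_sup (tuple_measure (hyp_measure R n) n.+1)
          (fun q => ((\prod_(j < n.+1) F j (tnth q j))
                       * hyp_det q `^ (n.+1%:R / p))%R%:E))%E.
Proof.
have [C C0 HC] := integral_frames_le R n.
exists (C `^ p^-1) => F FL F0.
have E0 : 0 < C `^ p^-1 by exact: powR_gt0.
pose D : R := n.+1%:R; have D0 : 0 < D by rewrite ltr0n.
pose k := p / D; have k0 : 0 < k by rewrite divr_gt0.
have mF j : measurable_fun setT (F j).
  by have := FL j; rewrite inE => /andP[/[1!inE]].
set f := (fun q => _%:E); set M := ess_sup _ f.
have f0 q : (0 <= f q)%E by rewrite lee_fin mulr_ge0 ?powR_ge0 ?prodr_ge0.
have T0 : (0 < tuple_measure (hyp_measure R n) n.+1 setT)%E.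
  have := @tuple_measure_box _ _ R (hyp_measure R n) n.+1 (fun=> setT)
    (fun=> measurableT).
  rewrite (_ : [set t | _] = setT); last by apply/seteqP; split.
  move=> ->; elim/big_ind : _ => //; first by move=> a b; exact: mule_gt0.
  by move=> i _; exact: hyp_measureT_gt0.
have M0 : (0 <= M)%E by apply: ess_sup_gee => //; exact: nearW.
have fM := ess_sup_ge (tuple_measure (hyp_measure R n) n.+1) f.
rewrite -/M in fM; move: M0 fM; case: M => [r|_ _|//]; last first.
  by rewrite gt0_muley ?lte_fin// leey.
rewrite lee_fin => r0 fr.
pose g j q := F j q `^ k.
have mg j : measurable_fun setT (g j).
  by apply: (measurableT_comp (measurable_powR k)); exact: mF.
have aeg : {ae tuple_measure (hyp_measure R n) n.+1, forall t,
    `|\det (\matrix_(i, j) (g j (tnth t j) * (tnth (hpt (tnth t j)) i : R)))|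
    <= r `^ k}.
  apply: filterS fr => t; rewrite lee_fin => ft.
  rewrite prod_det_powR// ge0_ler_powR ?nnegrE ?(ltW k0)//.
  by have := f0 t; rewrite lee_fin.
have [|N nN HN] := ae_det_le_pointwise
  (x := fun j i q => g j q * (tnth (hpt q) i : R)) _ aeg.
  by move=> j i; apply: measurable_funM => //; exact: measurable_coord.
have NE j : ('N[hyp_measure R n]_p%:E [EFin \o F j] =
    (\int[hyp_measure R n]_q ((g j q) ^+ n.+1)%:E) `^ p^-1)%E.
  rewrite unlock; congr (_ `^ _)%E; apply: eq_integral => q _.
  rewrite /= ger0_norm// -powR_mulrn ?powR_ge0// -powRrM.
  by rewrite /k divfK// gt_eqF.
have I0 j : (0 <= \int[hyp_measure R n]_q ((g j q) ^+ n.+1)%:E)%E.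
  by apply: integral_ge0 => q _; rewrite lee_fin exprn_ge0// powR_ge0.
have pV0 : 0 <= p^-1 by rewrite invr_ge0 ltW.
have [[j Hj]|[a [a0 Ha Hprod]]] := HC g N (r `^ k) mg
  (fun j q => powR_ge0 _ _) nN (powR_ge0 _ _) HN.
  rewrite (bigD1 j)//= NE Hj poweR0r ?invr_neq0 ?gt_eqF// mul0e.
  by rewrite mule_ge0 ?lee_fin ?(ltW E0).
apply: (@le_trans _ _ (\big[*%E/1]_(j < n.+1) (a j `^ p^-1)%:E)%E).
  apply: lee_prod => j; rewrite NE ?poweR_ge0// -poweR_EFin.
  by apply: gt0_ler_poweR; rewrite ?in_itv/= ?leey ?andbT ?lee_fin.
rewrite prodEFin -EFinM lee_fin -powR_prod//.
apply: (@le_trans _ _ ((C * (r `^ k) ^+ n.+1) `^ p^-1)).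
  rewrite ge0_ler_powR ?nnegrE ?prodr_ge0//.
  by rewrite mulr_ge0 ?exprn_ge0 ?powR_ge0// ltW.
rewrite powRM ?exprn_ge0 ?powR_ge0// ?(ltW C0)//.
have kE : k * (n.+1%:R * p^-1) = 1.
  by rewrite /k mulrA divfK ?gt_eqF// divff// gt_eqF.
by rewrite -powR_mulrn ?powR_ge0// -powRrM -powRrM kE powRr1.
Qed.
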